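(* Let $n\ge 3$, let $k$ be a field of positive characteristic $p$, let $a$ be a positive integer not divisible by $p$, and let $$R=\frac{k[x_1,\ldots,x_{n+1}]}{(x_1^a+\cdots+x_{n+1}^a)}$$ with homogeneous maximal ideal $\mathfrak{m}=(x_1,\ldots,x_{n+1})$. Let $e\ge 0$ be the smallest exponent such that $p^e\ge a$, let $\kappa=\lfloor p^e/a\rfloor$, and let $s=p^e-\kappa a$ be the remainder of $p^e$ modulo $a$. Then the diagonal F-threshold of $R$ is $$c^{\mathfrak{m}}(\mathfrak{m})=n+1-a\mathcal{M},$$ where $\mathcal{M}$ is the minimum of the five numbers $$\left\lceil\frac{(n+1)\kappa-n+1}{2}\right\rceil\frac{1}{p^e}+\frac{(n+1)s}{ap^e},\qquad \left\lceil\frac{(n+1)\kappa-n+2}{2}\right\rceil\frac{1}{p^e}+\frac{ns}{ap^e},$$ $$\left\lceil\frac{(n+1)\kappa+1}{2}\right\rceil\frac{1}{p^e}+\frac{s}{ap^e},\qquad \left\lceil\frac{(n+1)\kappa+2}{2}\right\rceil\frac{1}{p^e},\qquad \frac{1}{p^{e-1}}.$$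
   Context: For a ring $R$ of characteristic $p>0$ and ideals $\mathfrak{a},J\subset\mathfrak{m}$ with $\mathfrak{a}\subseteq\sqrt{J}$, the F-threshold of $\mathfrak{a}$ with respect to $J$ is $c^J(\mathfrak{a}):=\lim_{e\to\infty}\nu^J_{\mathfrak{a}}(p^e)/p^e$, where $\nu^J_{\mathfrak{a}}(p^e):=\max\{r\mid \mathfrak{a}^r\not\subset J^{[p^e]}\}$ and $J^{[p^e]}$ is the ideal generated by the $p^e$-th powers of elements of $J$. The diagonal F-threshold of $R$ is $c^{\mathfrak{m}}(\mathfrak{m})$. *)

(* Defs.v *)
From HB Require Import structures.
From mathcomp Require Import all_boot all_order all_algebra ring_quotient.
From mathcomp Require Import mpoly.
From mathcomp Require Import boolp classical_sets reals topology normedtype.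
From mathcomp Require Import sequences.

Set Implicit Arguments.
Unset Strict Implicit.
Unset Printing Implicit Defensive.

Import Order.TTheory GRing.Theory Num.Theory.
Import numFieldNormedType.Exports.

Local Open Scope classical_set_scope.
Local Open Scope ring_scope.

Section Ideals.
Variable R : comNzRingType.

(* The library's [idealr] only covers proper ideals; the unit ideal is needed
   here, for instance as the zeroth power of an ideal. *)
Definition is_ideal (I : set R) : Prop :=
  [/\ I 0, (forall x y, I x -> I y -> I (x + y)) &
      (forall b x, I x -> I (b * x))].

Definition ideal_gen (A : set R) : set R := smallest is_ideal A.

Definition ideal_mul (I J : set R) : set R :=
  ideal_gen [set z | exists x y, [/\ I x, J y & z = x * y]].

Definition ideal_pow (I : set R) (r : nat) : set R :=
  iter r (ideal_mul I) setT.

(* J^[q] *)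
Definition bracket_pow (J : set R) (q : nat) : set R :=
  ideal_gen [set x ^+ q | x in J].

(* r = nu^J_a(q) *)
Definition is_F_nu (a J : set R) (q r : nat) : Prop :=
  ~ (ideal_pow a r `<=` bracket_pow J q) /\
  (forall r', ~ (ideal_pow a r' `<=` bracket_pow J q) -> (r' <= r)%N).

(* c = c^J(a), including that all the maxima and the limit exist. *)
Definition is_F_threshold (K : realType) (p : nat) (a J : set R) (c : K)
    : Prop :=
  exists nu : nat -> nat,
    (forall e, is_F_nu a J (p ^ e) (nu e)) /\
    (nu e)%:R / (p ^ e)%:R @[e --> \oo] --> c.

End Ideals.

Section FermatRing.
Variables (k : fieldType) (N a : nat).

Definition fermat_poly : {mpoly k[N]} := \sum_(i < N) 'X_i ^+ a.

(* The positivity of [a] is an argument because quotients are only defined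
   for proper ideals. *)
Definition fermat_ideal of (0 < a)%N : {pred {mpoly k[N]}} :=
  fun g => `[< exists h, g = h * fermat_poly >].

Hypothesis a_gt0 : (0 < a)%N.

Lemma fermat_ideal_closed : idealr_closed (fermat_ideal a_gt0).
Proof.
split.
- by apply/asboolP; exists 0; rewrite mul0r.
- apply/negP => /asboolP [h /(congr1 (mmap idfun (fun=> 0)))].
  rewrite rmorph1 rmorphM /= /fermat_poly rmorph_sum /= big1 ?mulr0.
    by move/eqP; rewrite oner_eq0.
  by move=> i _; rewrite rmorphXn /= mmapX mmap1U expr0n eqn0Ngt a_gt0.
- move=> b x y /asboolP [g ->] /asboolP [h ->].
  by apply/asboolP; exists (b * g + h); rewrite mulrDl mulrA.
Qed.

HB.instance Definition _ :=
  isIdealr.Build {mpoly k[N]} (fermat_ideal a_gt0) fermat_ideal_closed.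

(* k[x_1, ..., x_N] / (x_1^a + ... + x_N^a) *)
Definition fermat_ring : comNzRingType :=
  {ideal_quot (fermat_ideal a_gt0 : idealr {mpoly k[N]})}.

Definition fermat_max : set fermat_ring :=
  ideal_gen [set (\pi_fermat_ring 'X_i)%qT | i in [set: 'I_N]].

End FermatRing.

Arguments fermat_max k N {a} a_gt0 _.

(* Main.v *)
Require Import Defs.
From mathcomp Require Import all_boot all_order all_algebra ring_quotient.
From mathcomp Require Import mpoly.
From mathcomp Require Import boolp classical_sets reals topology normedtype.
From mathcomp Require Import sequences.
From mathcomp Require Import zify ring lra.

(** Let N = n + 1, S = k[x_1, ..., x_N] and let f be the sum of the x_i ^ a.
    For Q a power of p, m^r is contained in m^[Q] exactly when every monomial
    of degree r lies in (x_1 ^ Q, ..., x_N ^ Q, f). The ring S / (x_i ^ Q) is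
    Gorenstein with socle degree N (Q - 1), so nu(Q) = N (Q - 1) - t, where t
    is the least degree of a nonzero class killed by f
    ([not_sub_of_ann], [ann_of_not_sub]). It remains to show that t / Q tends
    to a M; put q = p^e, Q = q P, kap = q / a, and let s be the remainder.

    Multiplication by f respects exponents modulo a. On each residue class it
    becomes multiplication by y_1 + ... + y_N, with y_i = x_i ^ a, in a ring
    k[y] / (y_i ^ c_i) where c_i differs by at most 1 from
    Q / a = kap P + s P / a. The question is thus how low the
    sum of the variables L can have a kernel in such a box.

    Upper bound. For P = 1 the exponents are kap (on l coordinates) and
    kap + 1. The Hilbert function of the box decreases strictly past the
    middle, which forces a kernel in the middle degree ([has_ann_middle]).
    This gives the first four numbers for l = N, N - 1, 1, 0. Frobenius
    powers move these annihilators to all P, and the powers of f themselves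
    give the fifth number ([degree_le]).

    Lower bound. When the degree is below p - 1 and below the middle, L is
    injective. This is an sl_2 argument in which the only denominators are
    squares of numbers less than p ([lefschetz]). For larger P, the lowest
    part of an annihilator in the box of exponents kap_i P + rho_i yields an
    annihilator in a box of exponents kap_i or kap_i + 1, to which the
    injectivity applies, and one in a box of exponents rho_i or P - rho_i,
    which is a problem of scale P ([scale_decomposition]). A bound at scale P
    which is stable under replacing c_i by P - c_i on sets of even size
    ([flip_bound]) then propagates from P to p P. The step needs N >= 4 and an
    odd p, which guarantee that every integer point of the cube [0, p]^N has
    an even flip with a large coordinate sum ([even_flip]). For p = 2 the
    quotient kap is 1, and the diagonal case can be closed by itself
    ([char2_bound]). The resulting bound involves all l between 0 and N; it is
    linear in l on each parity class, which leaves the four extreme values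
    ([mincost_le]). *)

Import Order.TTheory GRing.Theory Num.Theory.
Import numFieldNormedType.Exports.
Local Open Scope ring_scope.
Set Implicit Arguments.
Unset Strict Implicit.
Unset Printing Implicit Defensive.

(** * Annihilators in truncated polynomial rings *)

Section Annihilators.
Variables (k : fieldType) (N : nat).
Implicit Types (a : nat) (b m r : 'X_{1..N}) (c v : 'I_N -> nat).
Implicit Types (u : 'X_{1..N} -> k) (f g h : {mpoly k[N]}).

Definition below c b := [forall i, (b i < c i)%N].

(** Membership in the monomial ideal generated by the powers x_i ^ c_i. *)
Definition vanishes c h := forall b, below c b -> h@_b = 0.

(** The coefficient of f * u at b, for f the sum of the x_i ^ a; u is a bare
    function on exponents because residue classes, translates and
    restrictions of it have to be formed freely. *)
Definition shift_sum a u b : k := \sum_(i | (a <= b i)%N) u (b - U_(i) *+ a)%MM.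

Definition annihilates a c u := forall b, below c b -> shift_sum a u b = 0.

(** In degree t, some class in S / (x_i ^ c_i) is nonzero and killed by f. *)
Definition has_ann a c t :=
  exists2 u, annihilates a c u & exists2 b, below c b /\ mdeg b = t & u b != 0.

Lemma belowP c b : reflect (forall i, b i < c i)%N (below c b).
Proof. exact: forallP. Qed.

Lemma mcoeffXM m h b :
  ('X_[m] * h)@_b = if (m <= b)%MM then h@_(b - m) else 0.
Proof.
case: ifP => [mb|mb].
  by rewrite mulrC -{1}(submK mb) addmC mcoeffMX.
rewrite mcoeffM big1 // => -[i j] /= /eqP bij.
rewrite mcoeffX; case: eqP => [mi|]; last by rewrite mul0r.
suff mb' : (m <= b)%MM by rewrite mb' in mb.
apply/mnm_lepP => x.
by move/mnmP: bij => /(_ x) ->; rewrite mi mnmDE leq_addr.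
Qed.

Lemma mcoeff_fermat a h b :
  (fermat_poly k N a * h)@_b = shift_sum a (fun b => h@_b) b.
Proof.
rewrite /fermat_poly mulr_suml raddf_sum /= /shift_sum [RHS]big_mkcond /=.
apply: eq_bigr => i _; rewrite mpolyXn mcoeffXM.
congr (if _ then _ else _); apply/mnm_lepP/idP => [/(_ i)|le_ab j].
  by rewrite mulmnE mnm1E eqxx mul1n.
by rewrite mulmnE mnm1E; case: eqP => [<-|_]; rewrite ?mul1n ?mul0n.
Qed.

Lemma below_sub c b m : below c b -> below c (b - m)%MM.
Proof.
move=> /belowP bc; apply/belowP => i.
by apply: leq_ltn_trans (bc i); rewrite mnmBE leq_subr.
Qed.

Lemma vanishesM c g h : vanishes c h -> vanishes c (g * h).
Proof.
move=> h0 b bc; rewrite mcoeffM big1 // => -[i j] /= /eqP bij.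
rewrite [X in _ * X]h0 ?mulr0 //.
apply/belowP => x; move/belowP: bc => /(_ x); apply: leq_ltn_trans.
by move/mnmP: bij => /(_ x) ->; rewrite mnmDE leq_addl.
Qed.

Lemma vanishesD c g h : vanishes c g -> vanishes c h -> vanishes c (g + h).
Proof. by move=> g0 h0 b bc; rewrite mcoeffD g0 // h0 // addr0. Qed.

Lemma box_poly c u : exists2 h : {mpoly k[N]},
  forall b, below c b -> h@_b = u b & forall b, h@_b != 0 -> u b != 0.
Proof.
pose d := (\sum_i c i).+1; exists (\sum_(m : 'X_{1..N < d}) u m *: 'X_[m]).
  move=> b /belowP bc; apply: mcoeff_mpoly.
  by rewrite ltnS mdegE; apply: leq_sum => i _; exact: ltnW.
move=> b; apply: contra => /eqP ub; rewrite raddf_sum big1 //= => m _.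
by rewrite mcoeffZ mcoeffX; case: eqP => [->|]; rewrite ?ub ?mul0r ?mulr0.
Qed.

Lemma shift_sum_eq a c u u' b :
  (forall b, below c b -> u b = u' b) -> below c b ->
  shift_sum a u b = shift_sum a u' b.
Proof. by move=> uu' bc; apply: eq_bigr => i _; apply/uu'/below_sub. Qed.

Lemma annihilates_poly a c u : annihilates a c u ->
  exists2 h, vanishes c (fermat_poly k N a * h) &
    (forall b, below c b -> h@_b = u b) /\ (forall b, h@_b != 0 -> u b != 0).
Proof.
move=> ua; have [h hu hs] := box_poly c u; exists h => // b bc.
by rewrite mcoeff_fermat (shift_sum_eq _ hu bc) ua.
Qed.

Lemma pchar_mpoly p : p \in [pchar k] -> p \in [pchar {mpoly k[N]}].
Proof. by move=> pk; apply: (rmorph_pchar (@mpolyC N k)). Qed.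

Lemma expr_sum_pchar (R : comNzRingType) p e (I : Type) (r : seq I) (F : I -> R) :
  p \in [pchar R] ->
  (\sum_(i <- r) F i) ^+ (p ^ e) = \sum_(i <- r) F i ^+ (p ^ e).
Proof.
move=> pR; have pn : [pchar R].-nat (p ^ e)%N.
  by rewrite (eq_pnat _ (pcharf_eq pR)) pnatX pnat_id ?(pcharf_prime pR).
elim/big_rec2: _ => [|i x y _ <-]; last by rewrite exprDn_pchar.
by rewrite expr0n expn_eq0 eqn0Ngt prime_gt0 ?(pcharf_prime pR).
Qed.

Lemma fermat_poly_pow a p e : p \in [pchar k] ->
  fermat_poly k N a ^+ (p ^ e) = fermat_poly k N (a * p ^ e).
Proof.
move=> /pchar_mpoly pk; rewrite /fermat_poly expr_sum_pchar //.
by apply: eq_bigr => i _; rewrite exprM.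
Qed.

(** In characteristic p the power f ^ (p ^ e) is again a sum of powers of
    the variables, and it kills whatever f kills. *)
Lemma annihilates_pow a p e c u : p \in [pchar k] ->
  annihilates a c u -> annihilates (a * p ^ e) c u.
Proof.
move=> pk /annihilates_poly [h h0 [hu _]] b bc.
rewrite -(shift_sum_eq _ hu bc) -mcoeff_fermat -(fermat_poly_pow _ _ pk).
have: (0 < p ^ e)%N by rewrite expn_gt0 prime_gt0 ?(pcharf_prime pk).
by case: (p ^ e)%N => // j _; rewrite exprSr -mulrA; exact: (vanishesM _ h0).
Qed.

End Annihilators.

(** * Transfer between boxes *)

Section Transfer.
Variables (k : fieldType) (N : nat).
Implicit Types (a : nat) (b m r : 'X_{1..N}) (c v : 'I_N -> nat).
Implicit Types (u g : 'X_{1..N} -> k).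

Lemma mulmn1E i j a : (U_(i) *+ a)%MM j = if i == j :> 'I_N then a else 0%N.
Proof. by rewrite mulmnE mnm1E; case: eqP => _; rewrite ?mul1n ?mul0n. Qed.

Lemma has_ann_homog a c t : has_ann k a c t ->
  exists2 u : 'X_{1..N} -> k, annihilates a c u /\ (forall b, u b != 0 -> mdeg b = t) &
  exists2 b, below c b & u b != 0.
Proof.
move=> [u ua [b [bc bt] ub]].
exists (fun b => if mdeg b == t then u b else 0); last first.
  by exists b; rewrite ?bt ?eqxx.
split=> [b1 b1c|b1]; last by case: (mdeg b1 =P t) => // _; rewrite eqxx.
rewrite /shift_sum.
have deg_sub i : (a <= b1 i)%N -> mdeg (b1 - U_(i) *+ a)%MM = (mdeg b1 - a)%N.
  move=> ab; have {2}-> : b1 = (b1 - U_(i) *+ a + U_(i) *+ a)%MM.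
    rewrite submK //; apply/mnm_lepP => j; rewrite mulmn1E.
    by case: eqP => // <-.
  by rewrite mdegD mdegMn mdeg1 mul1n addnK.
have [e|ne] := eqVneq (mdeg b1 - a)%N t.
  apply: etrans (ua _ b1c); apply: eq_bigr => i ab.
  by rewrite deg_sub // e eqxx.
by rewrite big1 // => i ab; rewrite deg_sub // (negbTE ne).
Qed.

(** Multiplication by f preserves the exponents modulo a, so S splits into
    free modules of rank one over k[x_i ^ a], on each of which f acts as the
    sum of the variables. *)
Lemma annihilates_contract a c v r u :
  (forall i, r i < a)%N -> (forall i x, x < v i -> a * x + r i < c i)%N ->
  annihilates a c u -> annihilates 1 v (fun m => u (m *+ a + r)%MM).
Proof.
move=> ra vc ua m /belowP mv.
have bc : below c (m *+ a + r)%MM.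
  by apply/belowP => i; rewrite mnmDE mulmnE mulnC; apply: vc.
apply: etrans (ua _ bc); apply: eq_big => [i|i mi].
  rewrite mnmDE mulmnE; have := ra i; case: (m i) => [|x] ri; first by lia.
  by rewrite mulSn -addnA leq_addr.
congr u; apply/mnmP => j; rewrite !(mnmDE, mnmBE, mulmnE, mnm1E).
by case: (i =P j) => [ij|_]; [rewrite -?ij; nia | rewrite ?mul0n ?subn0].
Qed.

Lemma has_ann_expand a c v r t : (0 < a)%N ->
  (forall i, r i < a)%N -> (forall i x, (x < v i) = (a * x + r i < c i))%N ->
  has_ann k 1 v t -> has_ann k a c (a * t + mdeg r).
Proof.
move=> a0 ra vc [u ua [m [/belowP mv mt] um]].
pose q b : 'X_{1..N} := [multinom b i %/ a | i < N]%N.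
exists (fun b => if [forall i, b i %% a == r i]%N then u (q b) else 0).
  move=> b /belowP bc; case: (boolP [forall i, b i %% a == r i]%N) => br.
    have qv : below v (q b).
      apply/belowP => i; rewrite vc mnmE -(eqP (forallP br i)) mulnC -divn_eq.
      exact: bc.
    apply: etrans (ua _ qv); apply: eq_big => [i|i ab].
      by rewrite mnmE divn_gt0.
    have -> : [forall j, (b - U_(i) *+ a)%MM j %% a == r j]%N.
      apply/forallP => j; rewrite -(eqP (forallP br j)) mnmBE mulmn1E.
      case: (i =P j) => [<-|_]; last by rewrite subn0.
      by rewrite -{2}(subnK ab) modnDr.
    congr u; apply/mnmP => j; rewrite /q mnmE [RHS]mnmBE mnmE mnmBE !mulmn1E.
    case: (i =P j) => [<-|_]; last by rewrite !subn0.
    by rewrite -{2}(subnK ab) divnDr // divnn a0 addnK.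
  rewrite /shift_sum big1 // => i ab; case: ifP => // /forallP rb.
  case/negP: br; apply/forallP => j; rewrite -(eqP (rb j)) mnmBE mulmn1E.
  case: (i =P j) => [<-|_]; last by rewrite subn0.
  by rewrite -{1}(subnK ab) modnDr.
exists (m *+ a + r)%MM; last first.
  have -> : [forall i, (m *+ a + r)%MM i %% a == r i]%N.
    by apply/forallP => i; rewrite mnmDE mulmnE modnMDl modn_small.
  suff -> : q (m *+ a + r)%MM = m by [].
  by apply/mnmP => i; rewrite mnmE mnmDE mulmnE divnMDl // divn_small // addn0.
split; last by rewrite mdegD mdegMn mt mulnC.
by apply/belowP => i; rewrite mnmDE mulmnE mulnC -vc.
Qed.

Lemma has_ann_shift c r t : has_ann k 1 c t ->
  has_ann k 1 (fun i => c i + r i)%N (t + mdeg r).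
Proof.
move=> [u ua [b [/belowP bc bt] ub]].
exists (fun b => if (r <= b)%MM then u (b - r)%MM else 0); last first.
  exists (b + r)%MM; last by rewrite lem_addl addmK.
  by split; [apply/belowP => i; rewrite mnmDE ltn_add2r | rewrite mdegD bt].
move=> {bc bt ub}b /belowP bc.
have [/mnm_lepP rb|rb] := boolP (r <= b)%MM; last first.
  rewrite /shift_sum big1 // => i bi; case: ifP => // /mnm_lepP rb'.
  case/negP: rb; apply/mnm_lepP => j; apply: leq_trans (rb' j) _.
  by rewrite mnmBE leq_subr.
have bc' : below c (b - r)%MM.
  by apply/belowP => i; rewrite mnmBE; have := bc i; have := rb i; lia.
apply: etrans (ua _ bc'); rewrite /shift_sum big_mkcond [RHS]big_mkcond /=.
apply: eq_bigr => i _; rewrite mnmBE subn_gt0.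
case: (ltnP 0 (b i)) => bi; last by case: ifP => //; lia.
case: (ltnP (r i) (b i)) => ri.
  have -> : (r <= b - U_(i) *+ 1)%MM.
    apply/mnm_lepP => j; rewrite mnmBE mulmn1E.
    by case: eqP => [<-|_]; have := rb j; lia.
  congr u; apply/mnmP => j; rewrite !mnmBE; lia.
case: ifP => // /mnm_lepP /(_ i); rewrite mnmBE mulmn1E eqxx; lia.
Qed.

(** No term of the sum at a point above b0 leaves the translated box
    through one of its lower faces, except terms where u is zero. *)
Lemma annihilates_restrict c v b0 u :
  (forall r, below v r -> below c (b0 + r)%MM) ->
  (forall r i, below v r -> r i = 0%N -> (0 < b0 i)%N ->
     u (b0 + r - U_(i))%MM = 0) ->
  annihilates 1 c u -> annihilates 1 v (fun r => u (b0 + r)%MM).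
Proof.
move=> vc u0 ua r rv; rewrite -(ua _ (vc _ rv)) /shift_sum.
rewrite big_mkcond [RHS]big_mkcond /=; apply: eq_bigr => i _.
rewrite mnmDE; case: (posnP (r i)) => [r0|rp].
  by rewrite r0 addn0; case: ifP => // b0i; rewrite mulm1n u0.
rewrite addn_gt0 rp orbT; congr u; apply/mnmP => j.
rewrite !(mnmDE, mnmBE) mulmn1E; case: (i =P j) => [ij|_]; last by rewrite !subn0.
by rewrite -ij; lia.
Qed.

(** Take a point of the support of the degree of b whose i-th coordinate
    is maximal. If it could be increased inside the box, then at the point
    above it the sum would have only one nonzero term. *)
Lemma ann_degree_ge c u b i : annihilates 1 c u ->
  below c b -> u b != 0 -> (c i <= (mdeg b).+1)%N.
Proof.
move=> ua bc ub; rewrite leqNgt; apply/negP => tc.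
set t := mdeg b in tc; case/negP: ub; apply/eqP.
have le_deg b' : (b' i <= mdeg b')%N by rewrite mdegE (bigD1 i) //= leq_addr.
suff H n b' : mdeg b' = t -> below c b' -> (t < b' i + n)%N -> u b' = 0.
  by apply: (H t.+1) => //; lia.
elim: n b' => [|n IH] b' bt /belowP bc' tb.
  by have := le_deg b'; lia.
have bc'' : below c (b' + U_(i))%MM.
  apply/belowP => j; rewrite mnmDE mnm1E; case: eqP => [<-|_]; last by rewrite addn0.
  by have := le_deg b'; lia.
have := ua _ bc''; rewrite /shift_sum (bigD1 i) /=; last first.
  by rewrite mnmDE mnm1E eqxx addn1.
rewrite mulm1n addmK big1 ?addr0 // => j /andP[bj ij].
have {}bj : (0 < b' j)%N.
  by move: bj; rewrite mnmDE mnm1E eq_sym (negbTE ij) addn0.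
apply: IH.
- have : (U_(j) *+ 1 <= b' + U_(i))%MM.
    apply/mnm_lepP => l; rewrite mulmn1E; case: eqP => // <-.
    by rewrite mnmDE ltn_addr.
  by move/submK/(congr1 mdeg); rewrite !mdegD mdegMn !mdeg1; lia.
- exact: below_sub.
- rewrite mnmBE mnmDE mnm1E mulmn1E eqxx (negbTE ij); lia.
Qed.

End Transfer.

(** * A Lefschetz property in low degree *)

Section Lefschetz.
Variables (k : fieldType) (N : nat).
Implicit Types (b m r : 'X_{1..N}) (c v : 'I_N -> nat).
Implicit Types (u g : 'X_{1..N} -> k).

Lemma interpolate (I : finType) (f h : I -> nat) n :
  (forall i, f i <= h i)%N -> (\sum_i f i <= n <= \sum_i h i)%N ->
  exists2 g : I -> nat, (forall i, f i <= g i <= h i)%N & (\sum_i g i = n)%N.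
Proof.
elim: n => [|n IH] in f * => fh /andP[fn nh].
  exists f => [i|]; first by rewrite leqnn fh.
  by apply/eqP; rewrite -leqn0.
move: fn; rewrite leq_eqVlt => /predU1P[<-|fn].
  by exists f => // i; rewrite leqnn fh.
have [|g gP gn] := IH f fh; first by rewrite -ltnS fn ltnW.
have [i gi|gh] := pickP (fun i => g i < h i)%N; last first.
  suff : (\sum_i h i <= \sum_i g i)%N by rewrite gn leqNgt nh.
  by apply: leq_sum => i _; rewrite leqNgt gh.
exists (fun j => g j + (j == i))%N => [j|].
  by have /andP[] := gP j; case: eqP => [->|_]; rewrite ?addn0 ?addn1 ?gi //; lia.
by rewrite big_split /= gn (bigD1 i) //= eqxx big1 ?addn1 // => j /negbTE->.
Qed.

(** The lowering operator of sl_2 on the tensor product of the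
    representations k[x] / (x ^ v_i), scaled so that raising is
    multiplication by the sum of the variables. *)
Definition lower v g b : k :=
  \sum_i (b i).+1%:R * (v i - (b i).+1)%N%:R * g (b + U_(i))%MM.

(** The sl_2 relation [E, F] = H: the weight of degree d is
    2 d - sum (v_i - 1). *)
Lemma raise_lower v g b : below v b ->
  shift_sum 1 (lower v g) b =
  lower v (shift_sum 1 g) b
  + ((mdeg b).*2 + N)%N%:R * g b - (\sum_i v i)%N%:R * g b.
Proof.
move=> /belowP bv.
pose A i j := if (0 < b i)%N then
  ((b - U_(i) *+ 1)%MM j).+1%:R * (v j - ((b - U_(i) *+ 1)%MM j).+1)%N%:R *
    g (b - U_(i) *+ 1 + U_(j))%MM else 0.
pose B i j := if (0 < (b + U_(j))%MM i)%N then
  (b j).+1%:R * (v j - (b j).+1)%N%:R * g (b + U_(j) - U_(i) *+ 1)%MM else 0.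
have -> : shift_sum 1 (lower v g) b = \sum_i \sum_j A i j.
  rewrite /shift_sum big_mkcond; apply: eq_bigr => i _; rewrite /A.
  by case: ifP => // _; rewrite big1.
have -> : lower v (shift_sum 1 g) b = \sum_i \sum_j B i j.
  rewrite exchange_big /=; apply: eq_bigr => j _; rewrite /shift_sum /B.
  by rewrite mulr_sumr big_mkcond.
have AB i j : A i j = B i j +
    (if i == j then ((b i).*2 + 1)%N%:R * g b - (v i)%:R * g b else 0).
  rewrite /A /B; have [<-|ij] := eqVneq i j; last first.
    rewrite addr0 mnmDE mnm1E eq_sym (negbTE ij) addn0.
    case: ifP => // bi; rewrite mnmBE mulmn1E (negbTE ij) subn0.
    congr (_ * g _); apply/mnmP => l; rewrite !(mnmDE, mnmBE) mulmn1E mnm1E.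
    case: (i =P l) => [<-|_]; last by rewrite !subn0.
    by rewrite eq_sym (negbTE ij) !addn0.
  rewrite mnmDE mnm1E eqxx [(b i + true)%N]addn1 /= mulm1n addmK.
  rewrite mnmBE mnm1E eqxx subn1.
  have E : ((b i).+1%:R * (v i - (b i).+1)%N%:R + ((b i).*2 + 1)%:R - (v i)%:R
           = (b i)%:R * (v i - b i)%N%:R :> k).
    rewrite !natrB ?bv //; last by rewrite ltnW.
    by rewrite natrD -mul2n natrM -addn1 natrD; ring.
  have -> : (b i).+1%:R * (v i - (b i).+1)%N%:R * g b +
     (((b i).*2 + 1)%:R * g b - (v i)%:R * g b) = (b i)%:R * (v i - b i)%N%:R * g b.
    by rewrite -E !mulrBl !mulrDl addrA.
  case: (posnP (b i)) => [->|bi]; first by rewrite !mul0r.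
  rewrite prednK //; congr (_ * g _); rewrite submK //.
  by apply/mnm_lepP => l; rewrite mnm1E; case: eqP => // <-.
have ABi i : \sum_j A i j = \sum_j B i j +
    (((b i).*2 + 1)%N%:R * g b - (v i)%:R * g b).
  rewrite (eq_bigr _ (fun j _ => AB i j)) big_split /=; congr (_ + _).
  by rewrite -big_mkcond (big_pred1 i) // => j; rewrite eq_sym.
rewrite (eq_bigr _ (fun i _ => ABi i)) big_split /= -addrA; congr (_ + _).
rewrite sumrB -!mulr_suml -!natr_sum big_split /= sum1_card card_ord mdegE.
congr ((_ + _)%N%:R * _ - _).
by elim/big_rec2: _ => // i x y _ ->; rewrite doubleD.
Qed.

Lemma eq_lower v g g' b : (forall b, below v b -> g b = g' b) -> below v b ->
  lower v g b = lower v g' b.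
Proof.
move=> gg' /belowP bv; apply: eq_bigr => i _.
case: (ltngtP (b i).+1 (v i)) => [bi|bi|->]; last first.
- by rewrite subnn mulr0 !mul0r.
- by have := bv i; rewrite ltnNge -ltnS bi.
rewrite gg' //; apply/belowP => j; rewrite mnmDE mnm1E.
by case: eqP => [<-|_]; rewrite ?addn1 ?addn0.
Qed.

(** If E u = 0 in a degree s of weight -1, then E F^(j+1) u is
    - (j + 1)^2 F^j u, and for j at most s < p - 1 the factor is invertible.
    As F^(s+1) u has negative degree, going up in j gives u = 0. The general
    case reduces to weight -1 by shrinking the box. *)
Lemma lefschetz p v u b : p \in [pchar k] -> annihilates 1 v u ->
  below v b -> u b != 0 -> ((mdeg b).+1 < p)%N ->
  (\sum_i v i <= N + (mdeg b).*2)%N.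
Proof.
move=> pk ua /belowP bv ub sp; rewrite leqNgt; apply/negP => vN.
set s := mdeg b in sp vN.
(* A box of socle degree 2 s + 1 between b and v. *)
have [||w wP wN] := @interpolate _ (fun i => (b i).+1) v (N + s.*2).+1.
- exact: bv.
- rewrite vN andbT; under eq_bigr do rewrite -addn1.
  by rewrite big_split /= sum1_card card_ord -mdegE -/s; lia.
have wv i : (w i <= v i)%N by have /andP[] := wP i.
have bw : below w b by apply/belowP => i; have /andP[] := wP i.
have {}ua : annihilates 1 w u.
  move=> x /belowP xw; apply: ua; apply/belowP => i.
  exact: leq_trans (xw i) (wv i).
pose F j := iter j (lower w) u.
have EF j x : below w x -> (mdeg x + j = s)%N ->
    shift_sum 1 (F j.+1) x = - (j.+1 ^ 2)%:R * F j x.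
  elim: j x => [|j IH] x xw xs; rewrite [F _.+1]/= raise_lower //.
    have -> : lower w (shift_sum 1 (F 0%N)) x = 0.
      rewrite (@eq_lower _ _ (fun=> 0)) //.
      by rewrite /lower big1 // => i _; rewrite mulr0.
    rewrite add0r -mulrBl wN; congr (_ * _); rewrite -xs addn0.
    by rewrite !natrD -[(_ + _).+1]addn1 !natrD; ring.
  have -> : lower w (shift_sum 1 (F j.+1)) x = - (j.+1 ^ 2)%:R * F j.+1 x.
    rewrite /lower [F j.+1]/= mulr_sumr; apply: eq_bigr => i _.
    move/belowP: (xw) => xw'.
    case: (ltngtP (x i).+1 (w i)) => [xi|xi|->]; last first.
    - by rewrite subnn mulr0 !mul0r mulr0.
    - by have := xw' i; rewrite ltnNge -ltnS xi.
    rewrite IH; first by rewrite mulrCA.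
      apply/belowP => l; rewrite mnmDE mnm1E.
      by case: eqP => [<-|_]; rewrite ?addn1 ?addn0.
    by rewrite mdegD mdeg1; lia.
  rewrite -addrA -mulrBl -mulrDl; congr (_ * _).
  rewrite wN -xs -[(_ + _).+1]addn1 !natrD -!mul2n !natrM.
  by rewrite -[j.+2]addn1 !natrD -[j.+1]addn1 !natrD; ring.
have F0 n j x : (mdeg x < n)%N -> below w x -> (mdeg x + j = s)%N -> F j x = 0.
  elim: n j x => // n IH j x xn xw xs.
  have := EF _ _ xw xs; rewrite /shift_sum big1 => [|i xi].
    move/esym/eqP; rewrite mulNr oppr_eq0 mulf_eq0 => /orP[|/eqP //].
    rewrite natrX expf_eq0 /= -(dvdn_pcharf pk) => /dvdn_leq; lia.
  have/submK/(congr1 mdeg) : (U_(i) *+ 1 <= x)%MM.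
    by apply/mnm_lepP => l; rewrite mulmn1E; case: eqP => // <-.
  rewrite mdegD mdegMn mdeg1 => dx; apply: IH; [lia | exact: below_sub | lia].
by case/eqP: ub; apply: (F0 s.+1 0%N b); rewrite ?addn0.
Qed.

End Lefschetz.

(** * Separating the scales of a box *)

Section Scales.
Variables (k : fieldType) (N : nat).
Implicit Types (b m r : 'X_{1..N}) (c v : 'I_N -> nat).
Implicit Types (u g : 'X_{1..N} -> k).

(** Write exponents in base P. In the support of a homogeneous annihilator
    choose a point with the least total quotient s, and then with the fewest
    coordinates whose remainder is at least rho_i (the set J). Near this
    point two smaller annihilators appear: as the sum of the y_i ^ P also
    kills u, the points with the same remainders give one in the quotients;
    and by minimality nothing enters the block of points with the same
    quotients and the same J from below, which gives one in the remainders.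
    If moreover some quotient is not maximal, then the remainder of its
    coordinate runs up to P, and ann_degree_ge applies. *)
Lemma scale_decomposition p e P (kap rho : 'I_N -> nat) t :
  p \in [pchar k] -> P = (p ^ e)%N -> (forall i, rho i <= P)%N ->
  has_ann k 1 (fun i => kap i * P + rho i)%N t ->
  exists (J : {set 'I_N}) s d,
    [/\ t = (P * s + \sum_(i in J) rho i + d)%N,
        has_ann k 1 (fun i => kap i + (i \notin J))%N s,
        has_ann k 1 (fun i => if i \in J then P - rho i else rho i)%N d &
        (s < \sum_i kap i -> P * s.+1 <= t.+1)%N].
Proof.
move=> pk PE rhoP /has_ann_homog[u [ua ut] [b0 b0c ub0]].
have P0 : (0 < P)%N by rewrite PE expn_gt0 prime_gt0 ?(pcharf_prime pk).
set c := (fun i => _) in ua b0c.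
pose q b : 'X_{1..N} := [multinom b i %/ P | i < N]%N.
pose Jof b := [set i | rho i <= b i %% P]%N.
(* The factor N + 1 makes the key lexicographic, as #|Jof b| <= N. *)
pose key b := (mdeg (q b) * N.+1 + #|Jof b|)%N.
pose S n := `[< exists2 b, below c b /\ u b != 0 & key b = n >].
have [|n /asboolP[b [bc ub] bn] nmin] := @ex_minnP S.
  by exists (key b0); apply/asboolP; exists b0.
have {nmin bn} kmin b' : below c b' -> (key b' < key b)%N -> u b' = 0.
  move=> bc'; rewrite bn ltnNge => /negP H; apply/eqP; apply: contraT => ub'.
  by case: H; apply: nmin; apply/asboolP; exists b'.
move/belowP: (bc) => bc1.
set J := Jof b; set m := q b.
pose r : 'X_{1..N} := [multinom b i %% P | i < N]%N.
have rP i : (r i < P)%N by rewrite mnmE ltn_mod.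
have bE i : b i = (m i * P + r i)%N by rewrite !mnmE -divn_eq.
have bE' : b = (m *+ P + r)%MM.
  by apply/mnmP => i; rewrite mnmDE mulmnE -bE.
have inJ i : (i \in J) = (rho i <= r i)%N by rewrite inE mnmE.
pose x : 'X_{1..N} := [multinom if i \in J then rho i else 0 | i < N]%N.
have xi i : x i = (if i \in J then rho i else 0%N) by rewrite mnmE.
clearbody x.
have xr : (x <= r)%MM.
  by apply/mnm_lepP => i; rewrite xi inJ; case: ifP.
have mk i : (m i <= kap i)%N.
  have := bc1 i; rewrite /c bE; have := rhoP i; have := rP i; nia.
have mkJ i : i \in J -> (m i < kap i)%N.
  by rewrite inJ; have := bc1 i; rewrite /c bE; nia.
have tE : t = (P * mdeg m + mdeg r)%N.
  by rewrite -(ut _ ub) bE' mdegD mdegMn mulnC.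
have xE : mdeg x = (\sum_(i in J) rho i)%N.
  rewrite mdegE [RHS]big_mkcond; apply: eq_bigr => i _; exact: xi.
have rE : mdeg r = (mdeg x + mdeg (r - x))%N.
  by rewrite -mdegD addmC submK.
(* Leaving the block of b through a lower face decreases the key. *)
have small b' i : (forall j, j != i -> b' j %/ P = m j)%N -> (b' i %/ P < m i)%N ->
    (key b' < key b)%N.
  move=> b'm b'i; rewrite /key -/m.
  have lt_m : (mdeg (q b') < mdeg m)%N.
    rewrite !mdegE (bigD1 i) //= [X in (_ < X)%N](bigD1 i) //= mnmE.
    rewrite (eq_bigr m) => [|j ji]; last by rewrite mnmE b'm.
    by rewrite ltn_add2r.
  have JN : (#|Jof b'| <= N)%N by rewrite -[X in (_ <= X)%N]card_ord max_card.
  apply: (@leq_trans ((mdeg (q b')).+1 * N.+1)); last first.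
    by apply: leq_trans (leq_addr _ _); rewrite leq_mul2r lt_m orbT.
  by rewrite mulSn addnC ltn_add2r.
exists J, (mdeg m), (mdeg (r - x)); split.
- by rewrite -xE tE rE addnA.
- exists (fun m => u (m *+ P + r)%MM).
    apply: (@annihilates_contract _ _ P c) => // [i y|].
      rewrite inJ /c [(P * y)%N]mulnC; have := rP i.
    case: (leqP (rho i) (r i)) => rr /= ri yk; last first.
      have : (y * P <= kap i * P)%N by rewrite leq_mul2r; lia.
      by lia.
    have : (y.+1 * P <= kap i * P)%N by rewrite leq_mul2r; lia.
    by rewrite mulSn; lia.
    by rewrite PE -[(p ^ e)%N]mul1n; apply: annihilates_pow.
  exists m; last by rewrite -bE'.
  split=> //; apply/belowP => i; case: (boolP (i \in J)) => iJ.
    by rewrite addn0 mkJ.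
  by rewrite addn1 ltnS.
- exists (fun r => u (m *+ P + x + r)%MM); last first.
    exists (r - x)%MM; last by rewrite -addmA [(x + _)%MM]addmC submK // -bE'.
    split=> //; apply/belowP => i; rewrite mnmBE xi.
    have := rP i; have := rhoP i.
    by case: ifP; rewrite inJ ?subn0; lia.
  apply: (@annihilates_restrict _ _ c) => // [r' /belowP rv|r' i /belowP rv ri mi].
    apply/belowP => i; rewrite /c !mnmDE mulmnE xi.
    have := rv i; have := mk i; have := @mkJ i.
    by case: ifP => iJ; [move=> /(_ isT); nia | nia].
  have rlt j : (x j + r' j < P)%N.
    rewrite xi; have := rv j; have := rhoP j; have := rP j.
    by case: (boolP (j \in J)) => jJ; lia.
  have b'j j : j != i -> (m *+ P + x + r' - U_(i))%MM j = (m j * P + (x j + r' j))%N.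
    by move=> ji; rewrite mnmBE !mnmDE mulmnE mnm1E eq_sym (negbTE ji) subn0 addnA.
  have b'i : (m *+ P + x + r' - U_(i))%MM i = (m i * P + x i).-1.
    by rewrite mnmBE !mnmDE mulmnE mnm1E eqxx ri addn0 subn1.
  move: mi; rewrite mnmDE mulmnE => mi.
  apply: kmin.
    apply/belowP => j; have := mk j; have := @mkJ j.
    have [->|ji] := eqVneq j i.
      rewrite b'i /c; move: mi; rewrite xi; case: ifP; last by nia.
      by move=> iJ mi /(_ isT); nia.
    rewrite b'j // xi /c; have := rv j.
    by case: ifP => jJ; [move=> + /(_ isT); nia | nia].
  have [x0|xp] := posnP (x i).
    apply: (@small _ i) => [j ji|].
      by rewrite b'j // divnMDl // divn_small // addn0.
    by rewrite b'i x0 addn0 in mi *; rewrite ltn_divLR //; lia.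
  have iJ : i \in J by move: xp; rewrite xi; case: ifP.
  have rdiv : ((m *+ P + x + r' - U_(i))%MM i %/ P = m i)%N.
    rewrite b'i -subn1 -addnBA // divnMDl // divn_small ?addn0 //.
    by have := rlt i; lia.
  have rmod : ((m *+ P + x + r' - U_(i))%MM i %% P = (rho i).-1)%N.
    rewrite b'i -subn1 -addnBA // modnMDl modn_small; last by have := rlt i; lia.
    by rewrite xi iJ subn1.
  have qE : q (m *+ P + x + r' - U_(i))%MM = m.
    apply/mnmP => j; rewrite mnmE; have [->|ji] := eqVneq j i; first exact: rdiv.
    by rewrite b'j // divnMDl // divn_small // addn0.
  rewrite /key qE -/m ltn_add2l -/J; apply: proper_card; apply/properP; split.
    apply/fintype.subsetP => j; rewrite inE.
    have [->|ji] := eqVneq j i; first by rewrite iJ.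
    rewrite b'j // modnMDl modn_small //; have := rv j; rewrite xi.
    by case: ifP => //; lia.
  exists i => //; rewrite inE rmod -ltnNge prednK //.
  by move: xp; rewrite xi iJ.
rewrite mdegE => /= mkap.
have [i mi|mi] := pickP (fun i => m i < kap i)%N; last first.
  by move: mkap; rewrite ltnNge leq_sum // => i _; rewrite leqNgt mi.
pose w j := if (m j < kap j)%N then P else rho j.
have ya : annihilates 1 w (fun r => u (m *+ P + r)%MM).
  apply: (@annihilates_restrict _ _ c) => // [r' /belowP rv|r' j /belowP rv rj mj].
    apply/belowP => j; rewrite /c mnmDE mulmnE; have := rv j; rewrite /w.
    by have := mk j; case: (ltnP (m j) (kap j)); nia.
  have rlt l : (r' l < P)%N.
    by have := rv l; rewrite /w; case: ifP => // _; have := rhoP l; lia.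
  move: mj; rewrite mulmnE => mj.
  have b'l l : l != j -> (m *+ P + r' - U_(j))%MM l = (m l * P + r' l)%N.
    by move=> lj; rewrite mnmBE mnmDE mulmnE mnm1E eq_sym (negbTE lj) subn0.
  have b'j : (m *+ P + r' - U_(j))%MM j = (m j * P).-1.
    by rewrite mnmBE !mnmDE mulmnE mnm1E eqxx rj addn0 subn1.
  apply: kmin; last first.
    apply: (@small _ j) => [l lj|].
      by rewrite b'l // divnMDl // divn_small // addn0.
    by rewrite b'j ltn_divLR //; lia.
  apply/belowP => l; have := mk l; have [->|lj] := eqVneq l j.
    by rewrite b'j /c; nia.
  by rewrite b'l // /c; have := rv l; rewrite /w; case: (ltnP (m l) (kap l)); nia.
have rw : below w r.
  apply/belowP => j; rewrite /w; case: ifP => // mj.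
  by have := bc1 j; have := mk j; rewrite /c bE; nia.
have := @ann_degree_ge _ _ _ _ r i ya rw; rewrite -bE' /w mi => /(_ ub).
by rewrite tE mulnS -mdegE; lia.
Qed.

End Scales.

(** * Degrees of annihilators of a sum of variables *)

Section DegreeBounds.
Variables (k : fieldType) (N : nat).
Implicit Types (b m r : 'X_{1..N}) (c v : 'I_N -> nat).
Implicit Types (I J : {set 'I_N}).

(** With c_i / P in [0, 1], the bound says that t + 1 is at least
    P (1 - #|I| / 2) plus the sum of c_i over I, for some even I; replacing
    c_i by P - c_i for i in a set of even size permutes these expressions,
    up to a common constant. *)
Definition flip_bound P c t := exists2 I : {set 'I_N}, ~~ odd #|I| &
  (2 * P + 2 * \sum_(i in I) c i <= 2 * t.+1 + P * #|I|)%N.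

(** The set J selects a vertex kap_i P or (kap_i + 1) P of the cube that
    contains the exponents. At a vertex, the quotients of an annihilator have
    at least the middle degree of their box, rounded up (whence the parity
    term); the remainders over J measure the distance of the exponents to the
    vertex. *)
Definition carry_bound P (kap rho : 'I_N -> nat) t := exists J : {set 'I_N},
  (P * (\sum_i kap i + 2 + odd (\sum_i kap i + #|J|))
     + 2 * \sum_(i in J) rho i <= 2 * t.+1 + P * #|J|)%N.

Lemma sum_notin J : (\sum_i (i \notin J) + #|J| = N)%N.
Proof.
rewrite -sum1_card [X in (_ + X)%N]big_mkcond -big_split /=.
by rewrite (eq_bigr (fun=> 1%N)) ?sum1_card ?card_ord // => i _; case: ifP.
Qed.

(** The set I from the bound for the remainders changes the set J of
    scale_decomposition into the symmetric difference of J and I. The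
    evenness of #|I| keeps the parity, so that rounding up is compatible. *)
Lemma carry_of_flip p e P kap rho t : p \in [pchar k] -> P = (p ^ e)%N ->
  (forall c d, (forall i, c i <= P)%N -> has_ann k 1 c d -> flip_bound P c d) ->
  (forall i, rho i <= P)%N ->
  has_ann k 1 (fun i => kap i * P + rho i)%N t ->
  (p * P <= t.+1)%N \/ carry_bound P kap rho t.
Proof.
move=> pk PE flip rhoP /(scale_decomposition pk PE rhoP) [J [s [d [tE hs hd st]]]].
have ks : (\sum_i kap i <= 2 * s + #|J|)%N \/ (p * P <= t.+1)%N.
  have [sp|sp] := ltnP s.+1 p.
    have [u ua [b [bv bs] ub]] := hs; rewrite -bs in sp.
    have := lefschetz pk ua bv ub sp; rewrite big_split /= bs.
    have := sum_notin J.
    move: (\sum_i kap i)%N (\sum_i (i \notin J))%N #|J| => K Z C ZC KZ; left; lia.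
  have [|ks] := leqP (\sum_i kap i) (2 * s + #|J|); [by left | right].
  apply: leq_trans (st _); last by lia.
  by rewrite mulnC leq_mul2l sp orbT.
case: ks => [ks|]; [right | by left].
have [|I Ieven] := flip _ _ _ hd.
  by move=> i; case: ifP => _; rewrite ?leq_subr.
set J' := (J :\: I) :|: (I :\: J).
have disj : [disjoint J :\: I & I :\: J].
  rewrite -finset.setI_eq0; apply/eqP/setP => i.
  by rewrite !inE; case: (i \in I); case: (i \in J).
rewrite (big_setID J) /= (eq_bigr (fun i => P - rho i)%N); last first.
  by move=> i; rewrite inE => /andP[_ ->].
rewrite [(\sum_(i in I :\: J) _)%N](eq_bigr rho); last first.
  by move=> i; rewrite inE => /andP[/negbTE-> _].
have sumA : (\sum_(i in I :&: J) (P - rho i) + \sum_(i in J :&: I) rho i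
  = P * #|J :&: I|)%N.
  rewrite finset.setIC -big_split /= (eq_bigr (fun=> P)) => [|i _]; last by rewrite subnK.
  by rewrite sum_nat_const mulnC.
have sumJ : (\sum_(i in J) rho i =
  \sum_(i in J :&: I) rho i + \sum_(i in J :\: I) rho i)%N by exact: big_setID.
have cJ := cardsID I J; have cI := cardsID J I; rewrite finset.setIC in cI.
move: Ieven ks tE; rewrite sumJ -cI -cJ => Ieven ks tE hI.
exists J'; rewrite cardsU (eqP (_ : #|_ :&: _| == 0%N)) ?subn0; last first.
  by rewrite cards_eq0 finset.setI_eq0.
have -> : (\sum_(i in J') rho i =
  \sum_(i in J :\: I) rho i + \sum_(i in I :\: J) rho i)%N.
  by rewrite -bigU //; apply: eq_bigl => i; rewrite inE.
move: sumA tE ks hI Ieven.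
move: (\sum_(i in I :&: J) _)%N (\sum_(i in J :&: I) _)%N (\sum_(i in J :\: I) _)%N
  (\sum_(i in I :\: J) _)%N (\sum_i kap i)%N #|J :&: I| #|J :\: I| #|I :\: J|.
move=> X rA rB rC K A B C sumA tE ks hI Ieven.
have /(leq_mul (leqnn P)) : (K + odd (K + (B + C)) <= 2 * s + (A + B))%N by lia.
by rewrite !mulnDr tE; move: hI sumA; rewrite !mulnDr; lia.
Qed.

(** As p is odd, the larger of v_i and p - v_i is at least (p + 1) / 2, and
    for N >= 4 the sum of the larger ones is enough. If they are reached by
    an odd number of flips, the coordinate with the least gain is changed
    back; the others gain at least as much, and the parity of the total makes
    up for the last unit. *)
Lemma even_flip p v : odd p -> (3 < N)%N -> (forall i, v i <= p)%N ->
  exists2 I : {set 'I_N}, ~~ odd #|I| &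
    (2 * p + N + 2 * \sum_(i in I) v i
       <= \sum_i v i + 2 + odd (\sum_i v i + N) + p * #|I|)%N.
Proof.
move=> podd N3 vp.
pose D (I : {set 'I_N}) i := (if i \in I then p - v i else v i)%N.
have DE I : (\sum_i D I i + 2 * \sum_(i in I) v i = \sum_i v i + p * #|I|)%N.
  rewrite [(p * _)%N]mulnC -sum_nat_const big_distrr /= [X in (_ + X)%N]big_mkcond.
  rewrite [X in (_ = _ + X)%N]big_mkcond -!big_split /=.
  apply: eq_bigr => i _; rewrite /D; case: ifP; rewrite ?addn0 //.
  by have := vp i; lia.
suff [I Ieven WI] : exists2 I : {set 'I_N}, ~~ odd #|I| &
    (2 * p + N <= \sum_i D I i + 2 + odd (\sum_i v i + N))%N.
  by exists I => //; have := DE I; lia.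
pose I0 := [set i | 2 * v i < p]%N.
have D0 i : (p.+1 <= 2 * D I0 i)%N.
  by rewrite /D inE; have := vp i; case: (ltnP (2 * v i) p); lia.
have [odd0|even0] := boolP (odd #|I0|); last first.
  have [p' pE] : exists p', p = p'.+1 by exists p.-1; case: p podd {vp D DE I0 D0 even0}.
  exists I0 => //; suff : (N * p.+1 <= 2 * \sum_i D I0 i)%N.
    have := leq_mul N3 (leqnn p').
    by move: (\sum_i D I0 i)%N (\sum_i v i)%N => W V; rewrite pE; nia.
  rewrite -[X in (X * _)%N]card_ord -sum_nat_const big_distrr /=.
  by apply: leq_sum => i _; exact: D0.
have [i1 _] : exists i, i \in I0 by apply/card_gt0P; case: #|I0| odd0.
have [i0 _ Dmin] := arg_minnP (D I0) (isT : predT i1).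
pose I := if i0 \in I0 then I0 :\ i0 else i0 |: I0.
have Ieven : ~~ odd #|I|.
  rewrite /I; have := cardsD1 i0 I0; have := cardsU1 i0 I0.
  move: odd0; case: ifP => _ /=.
    by move: #|I0| #|I0 :\ i0| #|i0 |: I0| => x y z; lia.
  by move: #|I0| #|I0 :\ i0| #|i0 |: I0| => x y z; lia.
exists I => //.
have DI0 : (D I i0 = p - D I0 i0)%N.
  rewrite /D /I; case: (boolP (i0 \in I0)) => ii.
    by rewrite !inE eqxx /= subKn.
  by rewrite finset.setU11.
have DIi i : i != i0 -> D I i = D I0 i.
  by move=> ii; rewrite /D /I; case: (i0 \in I0); rewrite ?in_setD1 ?in_setU1 (negbTE ii).
have D0p : (D I0 i0 <= p)%N by rewrite /D; case: ifP => _; rewrite ?leq_subr ?vp.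
have sumE : (\sum_i D I i = p - D I0 i0 + \sum_(i | i != i0) D I0 i)%N.
  by rewrite (bigD1 i0) //= DI0; congr addn; apply: eq_bigr.
have sumD : (N.-1 * D I0 i0 <= \sum_(i | i != i0) D I0 i)%N.
  have -> : N.-1 = #|predC1 i0| by rewrite cardC1 card_ord.
  by rewrite -sum_nat_const; apply: leq_sum => i _; exact: Dmin.
have pari : odd (\sum_i D I i) = odd (\sum_i v i).
  have : odd (p * #|I|) = false by rewrite oddM (negbTE Ieven) andbF.
  move: (DE I); move: (p * #|I|)%N (\sum_i D I i)%N (\sum_i v i)%N (\sum_(i in I) v i)%N.
  by move=> X Y Z W; lia.
have := D0 i0; move: sumD sumE pari D0p.
move: (D I0 i0) (\sum_(i | _) D I0 i)%N (\sum_i D I i)%N (\sum_i v i)%N.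
move=> d S W V; nia.
Qed.

(** The bound is linear in each remainder, so that it can be tested at the
    vertices of the cube; there it is even_flip. *)
Lemma flip_of_carry p P c t : odd p -> (3 < N)%N -> (0 < P)%N ->
  (forall kap rho d, (forall i, rho i <= P)%N ->
     has_ann k 1 (fun i => kap i * P + rho i)%N d ->
     (p * P <= d.+1)%N \/ carry_bound P kap rho d) ->
  (forall i, c i <= p * P)%N -> has_ann k 1 c t -> flip_bound (p * P) c t.
Proof.
move=> podd N3 P0 carry cP hc.
have p0 : (0 < p)%N by case: p podd {carry cP}.
(* Capping the quotient at p - 1 leaves the remainder P when c_i = p P. *)
pose kap i := minn (c i %/ P) p.-1; pose rho i := (c i - kap i * P)%N.
have kapc i : (kap i * P <= c i)%N.
  by apply: leq_trans (leq_trunc_div (c i) P); rewrite leq_mul2r geq_minl orbT.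
have rhoP i : (rho i <= P)%N.
  rewrite leq_subLR /kap; case: (leqP (c i %/ P) p.-1) => cp.
    by rewrite {1}(divn_eq (c i) P) leq_add2l ltnW // ltn_mod.
  by rewrite addnC -mulSn prednK.
have cE : c = (fun i => kap i * P + rho i)%N.
  by apply/funext => i; rewrite addnC subnK.
rewrite cE in hc; have [pP|[J HJ]] := carry _ _ _ rhoP hc.
  by exists finset.set0; rewrite ?cards0 // big_set0; lia.
have [|I Ieven HI] := @even_flip p (fun i => kap i + (i \notin J))%N podd N3.
  by move=> i; rewrite /kap; case: (i \notin J) => /=; lia.
exists I => //.
move: HI; rewrite !big_split /=.
have sumIJ : (\sum_(i in I) (i \notin J) = #|I :\: J|)%N.
  rewrite -sum1_card big_mkcond [RHS]big_mkcond /=; apply: eq_bigr => i _.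
  by rewrite inE; case: (i \in I); case: (i \in J).
rewrite sumIJ; have := sum_notin J.
have cI : (\sum_(i in I) c i = (\sum_(i in I) kap i) * P + \sum_(i in I) rho i)%N.
  by rewrite cE big_split /= big_distrl.
have rI : (\sum_(i in I) rho i <= \sum_(i in J) rho i + P * #|I :\: J|)%N.
  rewrite (big_setID J) /= mulnC -sum_nat_const leq_add //; last exact: leq_sum.
  by rewrite [leqRHS](big_setID I) /= finset.setIC leq_addr.
rewrite cI; move: HJ rI.
move: (\sum_(i in I) rho i)%N (\sum_(i in J) rho i)%N (\sum_(i in I) kap i)%N
  (\sum_i kap i)%N #|I :\: J| #|I| #|J| (\sum_i (i \notin J))%N => rI rJ kI K C cI' cJ nJ.
move=> HJ rIJ nJE HI.
have oE : odd (K + nJ + N) = odd (K + cJ) by lia.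
rewrite {}oE in HI; move: (odd (K + cJ) : nat) HJ HI => o HJ HI.
have /(leq_mul (leqnn P)) : (2 * p + cJ + 2 * (kI + C) <= K + 2 + o + p * cI')%N by lia.
by clear - HJ rIJ; nia.
Qed.

(** Induction on the scale, alternating between the two kinds of bounds. *)
Lemma flip_bound_of_ann p e c t : p \in [pchar k] -> odd p -> (3 < N)%N ->
  (forall i, c i <= p ^ e)%N -> has_ann k 1 c t -> flip_bound (p ^ e) c t.
Proof.
move=> pk podd N3; elim: e c t => [|e IH] c t cP hc.
  by exists finset.set0; rewrite ?cards0 // big_set0 expn0; lia.
rewrite expnS in cP *; apply: flip_of_carry => //.
  by rewrite expn_gt0 odd_gt0.
by move=> kap rho d; exact: carry_of_flip pk erefl IH.
Qed.

Lemma has_ann_eq a c c' t : c =1 c' -> has_ann k a c t -> has_ann k a c' t.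
Proof. by move=> /funext ->. Qed.

(** For p = 2 and quotient 1, scale_decomposition gives 2 P <= t + 1 as soon
    as s > 0. For s = 0 the Lefschetz property forces J to be full, which
    leaves a box of exponents P - rho. *)
Lemma char2_step e P rho t : 2 \in [pchar k] -> (3 < N)%N -> P = (2 ^ e)%N ->
  (rho <= P)%N -> has_ann k 1 (fun _ : 'I_N => P + rho)%N t ->
  (2 * P <= t.+1)%N \/
  exists2 d, (2 * rho <= P)%N /\ t = (N * rho + d)%N &
             has_ann k 1 (fun _ : 'I_N => P - rho)%N d.
Proof.
move=> pk N3 PE rhoP hc.
have {}hc : has_ann k 1 (fun _ : 'I_N => 1 * P + rho)%N t by rewrite mul1n.
have [J [s [d [tE hs hd st]]]] := scale_decomposition pk PE (fun=> rhoP) hc.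
rewrite sum_nat_const card_ord muln1 in st.
have [s0|s0] := posnP s; last first.
  left; have [sN|Ns] := ltnP s N.
    by apply: leq_trans (st sN); rewrite mulnC leq_mul2l [(1 < _)%N]s0 orbT.
  have s2 : (1 < s)%N by apply: leq_trans Ns; lia.
  by have := leq_mul (leqnn P) s2; rewrite tE; lia.
rewrite {st}s0 in hs tE.
have JT : J = finset.setT.
  have [u ua [b [bv bs] ub]] := hs.
  have := lefschetz pk ua bv ub; rewrite bs => /(_ isT).
  rewrite big_split /= sum_nat_const card_ord muln1 addn0 => h.
  apply/eqP; rewrite eqEcard finset.subsetT cardsT card_ord /=.
  by have := sum_notin J; move: (\sum_i _)%N #|J| h => ? ?; lia.
rewrite {}JT in hd tE; rewrite sum_nat_const cardsT card_ord in tE.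
have [rP|rP] := leqP (2 * rho) P; last first.
  by left; have := leq_mul N3 (leqnn rho); rewrite tE; lia.
right; exists d; first by rewrite tE muln0 add0n.
by apply: has_ann_eq hd => i; rewrite inE.
Qed.

(** flip_bound fails in characteristic 2 (at c_i = 1 for P = 2), but on the
    diagonal the box of exponents P - rho = P / 2 + (P / 2 - rho) left by
    char2_step is of the same form at the previous scale. *)
Lemma char2_bound e P rho t : 2 \in [pchar k] -> (3 < N)%N -> P = (2 ^ e)%N ->
  (rho <= P)%N -> has_ann k 1 (fun _ : 'I_N => P + rho)%N t ->
  (2 * P <= t.+1)%N \/ (P + N * rho <= t.+1)%N.
Proof.
move=> pk N3; elim: e P rho t => [|e IH] P rho t PE rhoP hc.
all: have [|[d [rP tE] hd]] := char2_step pk N3 PE rhoP hc; first by left.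
  by right; rewrite tE PE expn0 in rP *; lia.
have P2 : P = (2 * 2 ^ e)%N by rewrite PE expnS.
have := IH (2 ^ e)%N (2 ^ e - rho)%N d erefl (leq_subr _ _).
case.
- by apply: has_ann_eq hd => i; lia.
- by right; rewrite tE; lia.
have := leq_mul N3 (leqnn (2 ^ e - rho)); have := leq_mul N3 (leqnn rho).
by left; rewrite tE; have : (N * rho + N * (2 ^ e - rho) = N * 2 ^ e)%N;
  [rewrite -mulnDr subnKC //; lia | have := leq_mul N3 (leqnn (2 ^ e)); lia].
Qed.

Lemma diagonal_bound p e P kap rho t :
  p \in [pchar k] -> P = (p ^ e)%N -> (3 < N)%N -> odd p || (kap == 1)%N ->
  (rho <= P)%N -> has_ann k 1 (fun _ : 'I_N => kap * P + rho)%N t ->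
  (p * P <= t.+1)%N \/ exists2 l, (l <= N)%N &
    (P * (N * kap + 2 + odd (N * kap + l)) + 2 * (l * rho)
      <= 2 * t.+1 + P * l)%N.
Proof.
move=> pk PE N3 pkap rhoP hc.
have [podd|peven] := boolP (odd p); last first.
  have p2 : p = 2 by apply/eqP; case: (even_prime (pcharf_prime pk)) peven => [->|->].
  rewrite (negbTE peven) /= in pkap; rewrite (eqP pkap) in hc *.
  have {}hc : has_ann k 1 (fun _ : 'I_N => P + rho)%N t.
    by apply: has_ann_eq hc => i; rewrite mul1n.
  rewrite p2 in pk PE *.
  have [|h] := char2_bound pk N3 PE rhoP hc; first by left.
  by right; exists N => //; rewrite muln1 addnn odd_double; nia.
have flip c d : (forall i, c i <= P)%N -> has_ann k 1 c d -> flip_bound P c d.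
  by rewrite PE; exact: flip_bound_of_ann.
have [|[J]] := carry_of_flip pk PE
  (fun c d cP => flip c d cP) (fun=> rhoP) hc; first by left.
rewrite !sum_nat_const card_ord => HJ; right; exists #|J| => //.
by rewrite -[X in (_ <= X)%N]card_ord max_card.
Qed.

End DegreeBounds.

(** * Annihilators in the middle degree *)

Section Counting.

Definition geom d : {poly int} := \sum_(j < d) 'X^j.

(** The coefficients are symmetric about T / 2 and decrease strictly with
    the distance to T / 2. *)
Definition peaked (T : nat) (p : {poly int}) :=
  [/\ forall a, (T < a)%N -> p`_a = 0,
      forall a, (a <= T)%N -> p`_(T - a) = p`_a &
      forall a b, (a <= T)%N -> (a < b)%N -> (T < a + b)%N -> p`_b < p`_a].

Lemma coef_mul_geom (p : {poly int}) d t :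
  (p * geom d)`_t = \sum_(j < d) (if (t < j)%N then 0 else p`_(t - j)).
Proof.
by rewrite /geom mulr_sumr coef_sum; apply: eq_bigr => j _; rewrite coefMXn.
Qed.

Lemma coef_geom d t : (geom d)`_t = (t < d)%N%:R.
Proof.
have := coef_mul_geom 1 d t; rewrite mul1r => ->.
have [td|td] := ltnP t d.
  rewrite (bigD1 (Ordinal td)) //= ltnn subnn coef1 eqxx big1 ?addr0 // => j jt.
  case: ltnP => // jt'; rewrite coef1 subn_eq0 leqNgt ltn_neqAle jt' andbT.
  by rewrite -val_eqE /= in jt; rewrite jt.
rewrite big1 // => j _; case: ltnP => // jt; rewrite coef1 subn_eq0 leqNgt.
by rewrite (leq_trans (ltn_ord j) td).
Qed.

Lemma coef_mul_geom_diff (p : {poly int}) d t : (d <= t.+1)%N ->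
  (p * geom d)`_t - (p * geom d)`_t.+1 = p`_(t.+1 - d) - p`_t.+1.
Proof.
move=> dt; have : (p * geom d) * ('X - 1) = p * 'X^d - p.
  by rewrite -mulrA [geom d * _]mulrC /geom -subrX1 mulrBr mulr1.
move/(congr1 (fun q : {poly int} => q`_t.+1)).
rewrite mulrBr mulr1 !coefB coefMX coefMXn /= [(t.+1 < d)%N]ltnNge dt /=.
by move=> ->.
Qed.

(** By coef_mul_geom_diff, consecutive coefficients of the product differ
    by two coefficients of p, and the one at t + 1 - d is the closer one to
    the middle of p. *)
Lemma peaked_mul_geom T d (p : {poly int}) : (0 < d)%N ->
  (forall a, (T < a)%N -> p`_a = 0) ->
  (forall a, (a <= T)%N -> p`_(T - a) = p`_a) ->
  (forall t, (T + d.-1 <= 2 * t)%N -> (t <= T + d.-1)%N ->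
     (d <= t.+1)%N /\ p`_t.+1 < p`_(t.+1 - d)) ->
  peaked (T + d.-1) (p * geom d).
Proof.
move=> d0 p0 psym pdec; set G := p * geom d.
have G0 a : (T + d.-1 < a)%N -> G`_a = 0.
  move=> Ta; rewrite coef_mul_geom big1 // => j _; case: ifP => // _.
  by rewrite p0 //; have := ltn_ord j; lia.
have Gsym a : (a <= T + d.-1)%N -> G`_(T + d.-1 - a) = G`_a.
  move=> aT; rewrite !coef_mul_geom [RHS](reindex_inj rev_ord_inj) /=.
  apply: eq_bigr => j _; have jd := ltn_ord j.
  case: (ltnP (T + d.-1 - a) j) => h1; case: (ltnP a (d - j.+1)) => h2 //.
  - by rewrite p0 //; lia.
  - by rewrite p0 //; lia.
  by rewrite -psym; [congr (_ `_ _); lia | lia].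
have Gdec t : (T + d.-1 <= 2 * t)%N -> (t <= T + d.-1)%N -> G`_t.+1 < G`_t.
  move=> h1 h2; have [h3 h4] := pdec t h1 h2.
  by rewrite -subr_gt0 coef_mul_geom_diff // subr_gt0.
have Gdec2 a b : (T + d.-1 <= 2 * a)%N -> (a <= T + d.-1)%N -> (a < b)%N -> G`_b < G`_a.
  move=> h1 h2; elim: b => // b IH; rewrite ltnS leq_eqVlt => /predU1P[<-|ab].
    exact: Gdec.
  have [bT|bT] := leqP b (T + d.-1); last first.
    by have := IH ab; rewrite (G0 b) // (G0 b.+1) // (leq_trans bT).
  by apply: lt_trans (IH ab); apply: Gdec => //; lia.
split=> // a b aT ab Tab; have [h|h] := leqP (T + d.-1) (2 * a).
  exact: Gdec2.
by rewrite -(Gsym a) //; apply: Gdec2; lia.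
Qed.

Lemma peaked_prod (kap : nat) (s : seq nat) : (0 < kap)%N -> (1 < size s)%N ->
  {in s, forall d, kap <= d <= kap.+1}%N ->
  peaked (\sum_(d <- s) d.-1) (\prod_(d <- s) geom d).
Proof.
move=> kap0; elim: s => // d1 [//|d2 s] IH _ sP.
have d1P := sP d1 (mem_head _ _).
have d2P : (kap <= d2 <= kap.+1)%N by apply: sP; rewrite !inE eqxx orbT.
rewrite !(big_cons _ _ d1) addnC mulrC; case: s => [|d3 s] in IH sP *.
  rewrite !big_cons !big_nil mulr1 addn0; apply: peaked_mul_geom; first by lia.
  - by move=> a h; rewrite coef_geom ltnNge; case: leqP => //; lia.
  - by move=> a h; rewrite !coef_geom; congr ((nat_of_bool _)%:R); lia.
  move=> t h1 h2; split; first by lia.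
  rewrite !coef_geom; have -> : (t.+1 < d2)%N = false by lia.
  by have -> : (t.+1 - d1 < d2)%N by lia.
have [|p0 psym pdec] := IH isT.
  by move=> d ds; apply: sP; rewrite inE ds orbT.
apply: peaked_mul_geom => //; first by lia.
move=> t; have : (d1 <= (\sum_(d <- [:: d2, d3 & s]) d.-1).+2)%N.
  by rewrite big_cons; lia.
move=> h1 h2 h3; split; first by lia.
by apply: pdec; lia.
Qed.

End Counting.

Section Existence.
Variables (k : fieldType) (N : nat).
Implicit Types (b m r : 'X_{1..N}) (c v : 'I_N -> nat).
Implicit Types (u g : 'X_{1..N} -> k).

Lemma kernel_exists (I J : finType) (A : I -> J -> k) : (#|J| < #|I|)%N ->
  exists2 c : I -> k, exists i, c i != 0 & forall j, \sum_i c i * A i j = 0.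
Proof.
move=> JI; pose M := \matrix_(x < #|I|, y < #|J|) A (enum_val x) (enum_val y).
have : kermx M != 0.
  rewrite -mxrank_eq0 mxrank_ker subn_eq0 -ltnNge.
  exact: leq_ltn_trans (rank_leq_col _) JI.
case/rowV0Pn => w /sub_kermxP wM w0; exists (fun i => w 0 (enum_rank i)).
  have [x wx] : exists x, w 0 x != 0.
    apply/existsP; rewrite -negb_forall; apply: contra w0 => /forallP h.
    by apply/eqP/rowP => x; rewrite mxE; apply/eqP.
  by exists (enum_val x); rewrite enum_valK.
move=> j; move/rowP/(_ (enum_rank j)): wM; rewrite !mxE => wM.
rewrite -[RHS]wM [LHS](reindex (@enum_val I I)) /=; last first.
  by apply: onW_bij; apply: enum_val_bij.
by apply: eq_bigr => x _; rewrite enum_valK mxE enum_rankK.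
Qed.

Definition box_mnm B (f : {ffun 'I_N -> 'I_B}) : 'X_{1..N} :=
  [multinom (f i : nat) | i < N].

Lemma box_mnmE B (f : {ffun 'I_N -> 'I_B}) i : box_mnm f i = f i.
Proof. exact: mnmE. Qed.

Lemma box_mnm_onto B c b : (forall i, c i <= B)%N -> below c b ->
  exists f : {ffun 'I_N -> 'I_B}, box_mnm f = b.
Proof.
move=> cB /belowP bc; have bB i : (b i < B)%N := leq_trans (bc i) (cB i).
exists [ffun i => Ordinal (bB i)]; apply/mnmP => i.
by rewrite box_mnmE ffunE.
Qed.

Lemma count_monomials B v t : (forall i, v i <= B)%N ->
  (\prod_(i < N) geom (v i))`_t
    = #|[pred f : {ffun 'I_N -> 'I_B} |
         below v (box_mnm f) && (mdeg (box_mnm f) == t)]|%:R.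
Proof.
move=> vB; pose F i (j : 'I_B) : {poly int} := if (j < v i)%N then 'X^j else 0.
rewrite (eq_bigr (fun i => \sum_j F i j)) => [|i _]; last first.
  rewrite /geom /F -big_mkcond /=.
  by rewrite -(big_ord_widen _ (fun j => 'X^j : {poly int}) (vB i)).
rewrite bigA_distr_bigA /= coef_sum -sum1_card natr_sum [RHS]big_mkcond /=.
apply: eq_bigr => f _; rewrite inE.
have [/belowP bf|] /= := boolP (below v (box_mnm f)).
  rewrite (eq_bigr (fun i => 'X^(f i))) => [|i _]; last first.
    by rewrite /F -box_mnmE bf.
  have -> : mdeg (box_mnm f) = (\sum_i f i)%N.
    by rewrite mdegE; apply: eq_bigr => i _; exact: box_mnmE.
  by rewrite prodrXr coefXn eq_sym; case: eqP.
rewrite negb_forall => /existsP[i]; rewrite box_mnmE => fi.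
by rewrite (bigD1 i) //= {1}/F (negbTE fi) mul0r coef0.
Qed.

(** Past the middle the Hilbert function of the box decreases strictly, so
    the sum of the variables cannot act injectively. *)
Lemma has_ann_middle (kap : nat) v : (0 < kap)%N -> (1 < N)%N ->
  (forall i, kap <= v i <= kap.+1)%N ->
  has_ann k 1 v (uphalf (\sum_i (v i).-1)).
Proof.
move=> kap0 N1 vP; set t := uphalf _.
have vB i : (v i <= kap.+1)%N by have /andP[] := vP i.
pose S d : pred {ffun 'I_N -> 'I_kap.+1} :=
  [pred f | below v (box_mnm f) && (mdeg (box_mnm f) == d)].
have lt_card : (#|{: {f | S t.+1 f}}| < #|{: {f | S t f}}|)%N.
  rewrite !card_sig -(ltr_nat int) -!count_monomials //.
  have [_ _ dec] : peaked (\sum_i (v i).-1)%N (\prod_(i < N) geom (v i)).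
    have sP : {in [seq v i | i in 'I_N], forall d, kap <= d <= kap.+1}%N.
      by move=> d /mapP[i _ ->].
    have := peaked_prod kap0 _ sP.
    by rewrite !big_image size_image card_ord => /(_ N1).
  apply: dec.
  - by rewrite /t; lia.
  - by [].
  - by rewrite /t; lia.
pose A (f : {f | S t f}) (f' : {f | S t.+1 f}) : k :=
  \sum_(i | (1 <= box_mnm (val f') i)%N)
    (box_mnm (val f) == box_mnm (val f') - U_(i) *+ 1)%MM%:R.
have [c [f cf] cA] := kernel_exists A lt_card.
have box_mnm_inj : injective (@box_mnm kap.+1).
  move=> f1 f2 /mnmP f12; apply/ffunP => i; apply/val_inj.
  by have := f12 i; rewrite !box_mnmE.
exists (fun b => \sum_f c f * (box_mnm (val f) == b)%:R); last first.
  have /andP[fv /eqP ft] := valP f.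
  exists (box_mnm (val f)) => //; rewrite (bigD1 f) //= eqxx mulr1 big1 ?addr0 // => f' ff'.
  by rewrite (inj_eq box_mnm_inj) val_eqE (negbTE ff') mulr0.
move=> b bv; rewrite /shift_sum exchange_big /=.
have [bt|bt] := eqVneq (mdeg b) t.+1; last first.
  rewrite big1 // => f' _; rewrite big1 // => i bi; case: eqP => [e|]; last by rewrite mulr0.
  case/eqP: bt; have /andP[_ /eqP <-] := valP f'; rewrite e.
  have /submK/(congr1 mdeg) : (U_(i) *+ 1 <= b)%MM.
    by apply/mnm_lepP => l; rewrite mulmn1E; case: eqP => // <-.
  by rewrite mdegD mdegMn mdeg1; lia.
have [g gb] := box_mnm_onto vB bv.
have Sg : S t.+1 g by rewrite /S /= gb bv bt eqxx.
rewrite -[RHS](cA (Sub g Sg)); apply: eq_bigr => f' _.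
by rewrite -mulr_sumr /A SubK gb.
Qed.

End Existence.

(** * The least degree of an annihilator of the Fermat polynomial *)

Section FrobeniusPowers.
Variables (k : fieldType) (N : nat).
Implicit Types (a : nat) (b m r : 'X_{1..N}) (c v : 'I_N -> nat).
Implicit Types (u : 'X_{1..N} -> k) (f g h : {mpoly k[N]}).

Lemma mcoeff_frobenius p e h b : p \in [pchar k] -> (h ^+ (p ^ e))@_b =
  \sum_(m <- msupp h) h@_m ^+ (p ^ e) * ((m *+ p ^ e)%MM == b)%:R.
Proof.
move=> /pchar_mpoly pk.
rewrite [in LHS](mpolyE h) (expr_sum_pchar _ _ _ (pk N)) raddf_sum /=.
by apply: eq_bigr => m _; rewrite exprZn mcoeffZ mcoeffXn.
Qed.

Lemma fermat_mul_homog a j h d b :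
  (forall b, h@_b != 0 -> mdeg b = d) ->
  (fermat_poly k N a ^+ j * h)@_b != 0 -> mdeg b = (d + a * j)%N.
Proof.
move=> hd; elim: j b => [|j IH] b; first by rewrite mul1r muln0 addn0; apply: hd.
rewrite exprS -mulrA mcoeff_fermat => hb.
have [i /andP[ab ib]] : exists i, (a <= b i)%N &&
    ((fermat_poly k N a ^+ j * h)@_(b - U_(i) *+ a) != 0).
  apply/existsP; apply: contraR hb; rewrite negb_exists => /forallP hb.
  rewrite /shift_sum big1 // => i ab.
  by have := hb i; rewrite ab /= negbK => /eqP.
have /submK/(congr1 mdeg) : (U_(i) *+ a <= b)%MM.
  by apply/mnm_lepP => l; rewrite mulmn1E; case: eqP => // <-.
by rewrite mdegD mdegMn mdeg1 mul1n IH // mulnS => <-; lia.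
Qed.

(** The last power of f that does not kill h gives an annihilator f ^ j * h.
    The product f ^ (n - 1) * h itself may lie in the ideal when the
    hypersurface is not F-pure. *)
Lemma has_ann_of_pow a c h d n :
  (forall b, h@_b != 0 -> mdeg b = d) -> ~ vanishes c h ->
  vanishes c (fermat_poly k N a ^+ n * h) ->
  exists2 j, (j < n)%N & has_ann k a c (d + a * j).
Proof.
move=> hd h0 hn; pose S j := `[< vanishes c (fermat_poly k N a ^+ j * h) >].
have [|j /asboolP Sj jmin] := @ex_minnP S; first by exists n; apply/asboolP.
have jn : (j <= n)%N by apply: jmin; apply/asboolP.
case: j => [|j] in Sj jmin jn *; first by rewrite mul1r in Sj.
exists j => //; have Sj' : ~~ S j by apply/negP => /jmin; rewrite ltnn.
exists (fun b => (fermat_poly k N a ^+ j * h)@_b).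
  by move=> b bc; rewrite -mcoeff_fermat mulrA -exprS Sj.
have [b bh] : exists b, below c b && ((fermat_poly k N a ^+ j * h)@_b != 0).
  apply: contrapT => /forallNP hb; case/negP: Sj'; apply/asboolP => b bc.
  by apply/eqP; apply: contraT => hb'; case: (hb b); rewrite bc.
have {bh}[bc bh] := andP bh.
by exists b => //; split=> //; apply: fermat_mul_homog bh.
Qed.

Lemma has_ann_frobenius p e a q t : p \in [pchar k] ->
  has_ann k a (fun _ : 'I_N => q) t ->
  exists2 t', (t' <= p ^ e * (t + a))%N &
    has_ann k a (fun _ : 'I_N => q * p ^ e)%N t'.
Proof.
move=> pk /has_ann_homog[u [ua ut] [b0 b0q ub0]].
have [h fh [hu hs]] := annihilates_poly ua.
set P := (p ^ e)%N; have P0 : (0 < P)%N by rewrite expn_gt0 prime_gt0 ?(pcharf_prime pk).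
have [|||j jP hj] := @has_ann_of_pow a (fun _ : 'I_N => q * P)%N (h ^+ P) (P * t) P.
- move=> b; rewrite mcoeff_frobenius // => hb.
  have [m /andP[mh /eqP mb]] : exists m, (h@_m != 0) && ((m *+ P)%MM == b).
    apply: contrapT => /forallNP h0; case/eqP: hb; rewrite big1_seq // => m /andP[_ mh].
    case: eqP => mb; last by rewrite mulr0.
    by case: (h0 m); rewrite -mcoeff_msupp mh mb eqxx.
  by rewrite -mb mdegMn (ut m) 1?mulnC // hs.
- move=> /(_ (b0 *+ P)%MM) h0; case/eqP: ub0; rewrite -hu //.
  apply/eqP; rewrite -[_ == 0]negbK -mcoeff_msupp; apply/negP => b0h.
  have : (h ^+ P)@_(b0 *+ P) = h@_b0 ^+ P.
    rewrite mcoeff_frobenius // (bigD1_seq b0) ?msupp_uniq //= eqxx mulr1 big1 ?addr0 //.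
    move=> m mb0; case: eqP => [/mnmP mP|]; last by rewrite mulr0.
    case/eqP: mb0; apply/mnmP => i; have := mP i; rewrite !mulmnE => /eqP.
    by rewrite eqn_pmul2r // => /eqP.
  rewrite h0; last by apply/belowP => i; rewrite mulmnE ltn_pmul2r //; apply/belowP: i.
  by move/esym/eqP; rewrite expf_eq0 P0 /= mcoeff_eq0 b0h.
- move=> b /belowP bP; rewrite -exprMn mcoeff_frobenius // big1_seq // => m /andP[_ mh].
  case: eqP => [mb|_]; last by rewrite mulr0.
  rewrite fh ?expr0n ?eqn0Ngt ?P0 ?mul0r //; apply/belowP => i.
  by have := bP i; rewrite -mb mulmnE ltn_pmul2r.
by exists (P * t + a * j)%N => //; rewrite mulnDr leq_add2l mulnC leq_mul2r ltnW ?orbT.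
Qed.

Lemma has_ann_fermat_pow p e a q : p \in [pchar k] -> (0 < q)%N ->
  (q <= a * p ^ e)%N ->
  exists2 t, (t <= a * p ^ e)%N & has_ann k a (fun _ : 'I_N => q) t.
Proof.
move=> pk q0 qa; have [|||j jP hj] := @has_ann_of_pow a (fun _ : 'I_N => q) 1 0 (p ^ e).
- by move=> b; rewrite mcoeff1; case: (b =P 0%MM) => [->|]; rewrite ?mdeg0 ?eqxx.
- move=> /(_ 0%MM); rewrite mcoeff1 eqxx => h; have /eqP := oner_neq0 k; apply.
  by apply: h; apply/belowP => i; rewrite mnm0E.
- move=> b /belowP bq; rewrite fermat_poly_pow // mcoeff_fermat /shift_sum big1 //.
  by move=> i ab; have := bq i; rewrite ltnNge (leq_trans qa).
by exists (a * j)%N => //; rewrite leq_mul2l ltnW ?orbT.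
Qed.

End FrobeniusPowers.

Section ThresholdDegree.
Variables (k : fieldType) (N p a e : nat).
Hypotheses (N3 : (3 < N)%N) (pk : p \in [pchar k]) (a0 : (0 < a)%N).
Local Notation q := (p ^ e)%N.
Hypotheses (aq : (a <= q)%N) (qpa : (q <= p * a)%N).
Local Notation kap := (q %/ a)%N.
Local Notation s := (q %% a)%N.
Hypotheses (oddk : odd p || (kap == 1)%N).

(** This is t + a for the degree t of the annihilator coming from the middle
    degree of a box with l exponents kap and N - l exponents kap + 1; the
    Frobenius multiplies t + a, rather than t, by p ^ m. *)
Definition cost l := (a * uphalf (N * kap + 2 - l) + l * s)%N.

Definition mincost :=
  minn (cost N) (minn (cost N.-1) (minn (cost 1) (minn (cost 0) (a * p)))).

Lemma kap_gt0 : (0 < kap)%N. Proof. by rewrite divn_gt0. Qed.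

Lemma leq_Nkap l : (l <= N -> l <= N * kap)%N.
Proof. by move/leq_trans; apply; apply: leq_pmulr kap_gt0. Qed.

Lemma cost_step l j : (l + 2 * j <= N)%N ->
  (cost l + 2 * j * s = cost (l + 2 * j) + a * j)%N.
Proof.
move=> lj; rewrite /cost; have lN := leq_Nkap lj.
have -> : uphalf (N * kap + 2 - l) = (uphalf (N * kap + 2 - (l + 2 * j)) + j)%N by lia.
by rewrite !mulnDr mulnDl; lia.
Qed.

(** By cost_step the cost is linear in l along each parity class, so its
    minimum is attained at the ends N, N - 1, 1, 0. *)
Lemma mincost_le l : (l <= N)%N -> (mincost <= cost l)%N.
Proof.
move=> lN; have [s2|s2] := leqP (2 * s) a.
  have up j : (l + 2 * j <= N)%N -> (cost (l + 2 * j) <= cost l)%N.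
    by move=> lj; have := cost_step lj; have := leq_mul s2 (leqnn j); lia.
  have [oNl|eNl] := boolP (odd (N - l)).
    have := up (N.-1 - l)./2; have -> : (l + 2 * (N.-1 - l)./2 = N.-1)%N by lia.
    by move=> /(_ (leq_pred N)); apply: leq_trans; rewrite /mincost; lia.
  have := up (N - l)./2; have -> : (l + 2 * (N - l)./2 = N)%N by lia.
  by move=> /(_ (leqnn N)); apply: leq_trans; rewrite /mincost; lia.
have down l' j : (l' + 2 * j = l)%N -> (cost l' <= cost l)%N.
  move=> lj; have := @cost_step l' j; rewrite lj => /(_ lN).
  by have := leq_mul (ltnW s2) (leqnn j); lia.
have [ol|el] := boolP (odd l).
  by apply: leq_trans (down 1%N l./2 _); [rewrite /mincost; lia | lia].
by apply: leq_trans (down 0%N l./2 _); [rewrite /mincost; lia | lia].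
Qed.

(** Contracting modulo a and enlarging the exponents to Q / a + 1 gives an
    annihilator of the sum of the variables in the box of exponents
    kap P + rho with rho = s P / a + 1, at a cost of at most N in degree; then
    diagonal_bound applies. *)
Lemma degree_ge m t : has_ann k a (fun _ : 'I_N => q * p ^ m)%N t ->
  (p ^ m * mincost <= t + a * N.+1)%N.
Proof.
move=> [u ua [b [/belowP bq bt] ub]]; set P := (p ^ m)%N in ua bq *.
set Q := (q * P)%N in ua bq.
pose r : 'X_{1..N} := [multinom b i %% a | i < N]%N.
pose y : 'X_{1..N} := [multinom b i %/ a | i < N]%N.
have rE i : r i = (b i %% a)%N by rewrite mnmE.
have yE i : y i = (b i %/ a)%N by rewrite mnmE.
have bE : b = (y *+ a + r)%MM.
  by apply/mnmP => i; rewrite mnmDE mulmnE yE rE -divn_eq.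
have ra i : (r i < a)%N by rewrite rE ltn_mod.
have Qlt x i : (x * a + r i < Q -> x < Q %/ a + (r i < Q %% a))%N.
  have := divn_eq Q a; move: (Q %/ a)%N (Q %% a)%N (ltn_pmod Q a0) => K S Sa ->.
  by have := ra i; case: (ltnP (r i) S) => rS /=; nia.
have Qlt' x i : (x < Q %/ a + (r i < Q %% a) -> x * a + r i < Q)%N.
  have := divn_eq Q a; move: (Q %/ a)%N (Q %% a)%N (ltn_pmod Q a0) => K S Sa ->.
  by have := ra i; case: (ltnP (r i) S) => rS /=; nia.
have hc : has_ann k 1 (fun i : 'I_N => Q %/ a + (r i < Q %% a))%N (mdeg y).
  exists (fun m => u (m *+ a + r)%MM); last first.
    exists y; last by rewrite -bE.
    split=> //; apply/belowP => i; have := bq i.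
    have -> : b i = (y i * a + r i)%N by rewrite yE rE -divn_eq.
    exact: Qlt.
  apply: annihilates_contract ua => // i x.
  by rewrite mulnC; apply: Qlt'.
(* The shift by d equalizes the exponents Q / a and Q / a + 1. *)
pose d : 'X_{1..N} := [multinom (Q %% a <= r i : nat) | i < N]%N.
have dE i : d i = (Q %% a <= r i)%N by rewrite mnmE.
have dN : (mdeg d <= N)%N.
  rewrite mdegE -[X in (_ <= X)%N]card_ord -sum1_card; apply: leq_sum => i _.
  by rewrite mnmE leq_b1.
pose rho := (s * P %/ a).+1.
have QE : (Q %/ a = kap * P + s * P %/ a)%N.
  by rewrite /Q {1}(divn_eq q a) mulnDl mulnAC divnMDl.
have rhoP : (rho <= P)%N.
  rewrite /rho ltn_divLR // mulnC ltn_pmul2l ?ltn_mod //.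
  by rewrite expn_gt0 prime_gt0 ?(pcharf_prime pk).
have {}hc : has_ann k 1 (fun _ : 'I_N => kap * P + rho)%N (mdeg y + mdeg d).
  apply: has_ann_eq (has_ann_shift d hc) => i; rewrite dE QE /rho.
  by case: (ltnP (r i) (Q %% a)) => _ /=; rewrite ?addn0 ?addn1 ?addnS.
have yt : (a * mdeg y <= t)%N.
  by rewrite -bt bE mdegD mdegMn mulnC leq_addr.
have yd : (a * (mdeg y + mdeg d).+1 <= t + a * N.+1)%N.
  by rewrite -addnS mulnDr leq_add // leq_mul2l ltnS dN orbT.
apply: leq_trans yd.
have [pP|[l lN hl]] := diagonal_bound pk erefl N3 oddk rhoP hc.
  apply: (@leq_trans (P * (a * p))); last first.
    by rewrite mulnCA leq_mul2l [(P * p)%N]mulnC pP orbT.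
  by rewrite leq_mul2l /mincost; lia.
apply: (@leq_trans (P * cost l)); first by rewrite leq_mul2l mincost_le ?orbT.
have lk := leq_Nkap lN.
set g := uphalf (N * kap + 2 - l).
have gE : (N * kap + 2 + odd (N * kap + l) = 2 * g + l)%N by rewrite /g; lia.
move: hl; rewrite gE mulnDr -addnA [(P * l + _)%N]addnC addnA leq_add2r.
rewrite mulnCA -mulnDr leq_mul2l /= -/P => hl.
rewrite /cost -/g; apply: (@leq_trans (a * (P * g + l * rho))); last first.
  by rewrite leq_mul2l hl orbT.
rewrite !mulnDr mulnCA leq_add2l [leqRHS]mulnCA mulnCA leq_mul2l.
apply/orP; right; rewrite mulnC ltnW // [(a * _)%N]mulnC -ltn_divLR //.
Qed.

(** For s > 0 take the residues s on l coordinates and 0 on the others: the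
    contracted exponents are kap and kap + 1. For s = 0 all contracted
    exponents are kap, and l = N is the cheapest choice. *)
Lemma has_ann_cost l : (l <= N)%N ->
  exists2 t, (t + a <= cost l)%N & has_ann k a (fun _ : 'I_N => q) t.
Proof.
move=> lN.
have G l' : (l' <= N)%N -> uphalf (N * kap + 2 - l') = (uphalf (N * kap - l')).+1.
  by move=> /leq_Nkap; lia.
have qE : q = (a * kap + s)%N by rewrite mulnC -divn_eq.
have [s0|s0] := posnP s.
  exists (a * uphalf (N * kap - N))%N.
    rewrite addnC -mulnS -G // /cost (leq_trans _ (leq_addr _ _)) //.
    by rewrite leq_mul2l; lia.
  have := @has_ann_expand k N a (fun _ => q) (fun _ => kap) 0%MM (uphalf (N * kap - N)).
  rewrite mdeg0 addn0; apply=> // [i|i x|].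
  - by rewrite mnm0E.
  - by rewrite mnm0E addn0 [X in _ = (_ < X)%N]qE s0 addn0 ltn_pmul2l.
  have := @has_ann_middle k N kap (fun _ => kap) kap_gt0.
  rewrite sum_nat_const card_ord -subn1 mulnBr muln1; apply; first by lia.
  by move=> i; lia.
exists (a * uphalf (N * kap - l) + l * s)%N.
  by rewrite /cost G // mulnS; lia.
pose r : 'X_{1..N} := [multinom if (i < l)%N then s else 0%N | i < N].
have suml : (\sum_(i < N) (i < l)%N = l)%N.
  rewrite -big_mkcond /= sum1_card -[RHS](card_ord l).
  have -> : #|[pred i : 'I_N | (i < l)%N]| = #|[seq widen_ord lN j | j in 'I_l]|.
    apply: eq_card => i; rewrite inE.
    apply/idP/mapP => [il|[j _ ->]]; last by apply: (valP j).
    by exists (Ordinal il); [rewrite mem_enum | apply/val_inj].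
  by rewrite card_image // => i j /(congr1 val)/= /val_inj.
have -> : (l * s = mdeg r)%N.
  rewrite mdegE -{1}suml big_distrl /=; apply: eq_bigr => i _.
  by rewrite mnmE; case: ifP; rewrite ?mul1n.
apply: (@has_ann_expand k N a (fun _ => q) (fun i => kap + (l <= i))%N) => //.
- by move=> i; rewrite mnmE; case: ifP => _ //; rewrite ltn_mod.
- move=> i x; rewrite mnmE [X in _ = (_ < X)%N]qE; have := ltn_pmod q a0.
  case: (ltnP i l) => il /= sa; first by rewrite addn0 ltn_add2r ltn_pmul2l.
  by rewrite addn0 addn1 ltnS; apply/idP/idP; nia.
have -> : (N * kap - l = \sum_(i < N) (kap + (l <= i)).-1)%N.
  have : (\sum_(i < N) (kap + (l <= i)).-1 + \sum_(i < N) (i < l) = \sum_(i < N) kap)%N.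
    rewrite -big_split /=; apply: eq_bigr => i _; have := kap_gt0.
    by case: (ltnP i l) => _ /=; lia.
  by rewrite suml sum_nat_const card_ord => <-; rewrite addnK.
apply: (@has_ann_middle k N kap) => //; first exact: kap_gt0.
  by lia.
by move=> i; case: (l <= i)%N => /=; lia.
Qed.

(** Frobenius carries an annihilator from level e to level e + m; the term
    a p of mincost comes from the powers of f alone. *)
Lemma degree_le m : exists2 t, (t <= p ^ m * mincost)%N &
  has_ann k a (fun _ : 'I_N => q * p ^ m)%N t.
Proof.
have P0 : (0 < p ^ m)%N by rewrite expn_gt0 prime_gt0 ?(pcharf_prime pk).
have costP l : (l <= N)%N -> exists2 t, (t <= p ^ m * cost l)%N &
    has_ann k a (fun _ : 'I_N => q * p ^ m)%N t.
  move=> lN; have [t tl ht] := has_ann_cost lN.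
  have [t' tt' ht'] := has_ann_frobenius m pk ht; exists t' => //.
  by apply: leq_trans tt' _; rewrite leq_mul2l tl orbT.
have powP : exists2 t, (t <= p ^ m * (a * p))%N &
    has_ann k a (fun _ : 'I_N => q * p ^ m)%N t.
  have [||t tl ht] := @has_ann_fermat_pow k N p m.+1 a (q * p ^ m)%N pk.
  - by rewrite muln_gt0 (leq_trans a0 aq) P0.
  - by rewrite expnS mulnA leq_mul2r [(a * p)%N]mulnC qpa orbT.
  by exists t => //; rewrite mulnC -mulnA -expnS.
rewrite /mincost; case: (leqP (cost N) _) => _; first exact: costP.
case: (leqP (cost N.-1) _) => _; first by apply: costP; lia.
case: (leqP (cost 1) _) => _; first by apply: costP; lia.
by case: (leqP (cost 0) _) => _; [apply: costP | exact: powP].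
Qed.

End ThresholdDegree.

(** * From F-thresholds to annihilators *)

Section Ideals.
Variable R : comNzRingType.
Implicit Types (I A : set R) (x y z : R).

Lemma ideal_gen_ideal A : is_ideal (ideal_gen A).
Proof.
split=> [I [[]] // | x y Ax Ay I IA | z x Ax I IA].
  by have [[_ ID _] _] := IA; apply: ID; [apply: Ax | apply: Ay].
by have [[_ _ IM] _] := IA; apply: IM; apply: Ax.
Qed.

Lemma mem_ideal_gen A x : A x -> ideal_gen A x.
Proof. by move=> Ax I [_]; apply. Qed.

Lemma ideal_gen_min A I : is_ideal I -> (forall x, A x -> I x) ->
  forall x, ideal_gen A x -> I x.
Proof. by move=> II AI x; apply. Qed.

Lemma ideal_sum I (T : eqType) (r : seq T) (P : pred T) (F : T -> R) : is_ideal I ->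
  (forall i, i \in r -> P i -> I (F i)) -> I (\sum_(i <- r | P i) F i).
Proof.
move=> [I0 ID _] IF; rewrite big_seq_cond; elim/big_rec: _ => // i x /andP[ir Pi] Ix.
exact: ID (IF i ir Pi) Ix.
Qed.

End Ideals.

Section LinearAlgebra.
Variable k : fieldType.

Lemma span_or_functional (I J : finType) (A : I -> J -> k) (v : J -> k) :
  (exists c : I -> k, forall j, v j = \sum_i c i * A i j) \/
  (exists2 w : J -> k, forall i, \sum_j A i j * w j = 0 & \sum_j v j * w j != 0).
Proof.
pose M := \matrix_(x < #|I|, y < #|J|) A (enum_val x) (enum_val y).
pose V := \row_(y < #|J|) v (enum_val y).
have ME x y : M x y = A (enum_val x) (enum_val y) by rewrite mxE.
have VE y : V 0 y = v (enum_val y) by rewrite mxE.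
have sumE (T : finType) (F : T -> k) : \sum_i F i = \sum_(x < #|T|) F (enum_val x).
  by rewrite (reindex (@enum_val T T)) //; apply: onW_bij; apply: enum_val_bij.
have [/submxP[c Vc]|] := boolP (V <= M)%MS; [left | rewrite submxE => VM; right].
  exists (fun i => c 0 (enum_rank i)) => j.
  have := congr1 (fun W : 'rV_ _ => W 0 (enum_rank j)) Vc.
  rewrite VE enum_rankK => ->; rewrite mxE [RHS]sumE.
  by apply: eq_bigr => x _; rewrite enum_valK ME enum_rankK.
have [y Vy] : exists y, (V *m cokermx M) 0 y != 0.
  apply/existsP; rewrite -negb_forall; apply: contra VM => /forallP h.
  by apply/eqP/rowP => y; rewrite [RHS]mxE; apply/eqP.
exists (fun j => cokermx M (enum_rank j) y).
  move=> i; have /matrixP/(_ (enum_rank i) y) := mulmx_coker M.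
  rewrite [RHS]mxE mxE => h; rewrite -[RHS]h [LHS]sumE.
  by apply: eq_bigr => x _; rewrite enum_valK ME enum_rankK.
apply: contra_neq Vy => w0; rewrite -[RHS]w0 [LHS]mxE [RHS]sumE.
by apply: eq_bigr => x _; rewrite enum_valK VE.
Qed.

End LinearAlgebra.

Section Duality.
Variables (k : fieldType) (N p a e : nat) (R : comNzRingType).
Variable phi : {rmorphism {mpoly k[N]} -> R}.
Local Notation f := (fermat_poly k N a).
Hypothesis phi_onto : forall z, exists g, phi g = z.
Hypothesis phi_ker : forall g, phi g = 0 <-> exists h, g = h * f.
Hypothesis pk : p \in [pchar k].
Local Notation q := (p ^ e)%N.
Local Notation box := (fun _ : 'I_N => q).
Local Notation max := (ideal_gen [set phi 'X_i | i in [set: 'I_N]]).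

Lemma q_gt0 : (0 < q)%N.
Proof. by rewrite expn_gt0 prime_gt0 ?(pcharf_prime pk). Qed.

Lemma max_var i : max (phi 'X_i).
Proof. by apply: mem_ideal_gen; exists i. Qed.

Lemma split_var (b : 'X_{1..N}) i : (0 < b i)%N ->
  exists2 b', b = (U_(i) + b')%MM & mdeg b = (mdeg b').+1.
Proof.
move=> bi; have bE : b = (U_(i) + (b - U_(i)))%MM.
  by rewrite addmC submK //; apply/mnm_lepP => j; rewrite mnm1E; case: eqP => // <-.
by exists (b - U_(i))%MM => //; rewrite {1}bE mdegD mdeg1.
Qed.

Lemma mdeg_gt0_var (b : 'X_{1..N}) r : mdeg b = r.+1 -> exists i, (0 < b i)%N.
Proof.
move=> br; apply/existsP; apply: contra_eqT br; rewrite negb_exists => /forallP b0.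
by rewrite mdegE big1 // => i _; apply/eqP; rewrite -leqn0 leqNgt.
Qed.

Lemma monomial_ideal_pow (b : 'X_{1..N}) : ideal_pow max (mdeg b) (phi 'X_[b]).
Proof.
move br : (mdeg b) => r; elim: r b br => [//|r IH] b br.
have [i bi] := mdeg_gt0_var br; have [b' bE bd] := split_var bi.
rewrite bE mpolyXD rmorphM; apply: mem_ideal_gen.
exists (phi 'X_i), (phi 'X_[b']); split=> //; first exact: max_var.
by apply: IH; move: bd; rewrite br => -[].
Qed.

Lemma ideal_pow_sub r (W : set R) : is_ideal W ->
  (forall b : 'X_{1..N}, mdeg b = r -> W (phi 'X_[b])) ->
  forall z, ideal_pow max r z -> W z.
Proof.
elim: r W => [|r IH] W WI Wb z.
  move=> _; have [_ _ WM] := WI; rewrite -[z]mulr1; apply: WM.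
  by have := Wb 0%MM (@mdeg0 N); rewrite mpolyX0 rmorph1.
have [W0 WD WM] := WI.
apply: ideal_gen_min => // _ [x [y [mx ym ->]]].
suff : forall y, ideal_pow max r y -> forall x, max x -> W (x * y) by apply.
apply: IH => [|b br x'].
  split=> [x' _|x1 x2 h1 h2 x' mx'|c x1 h1 x' mx']; first by rewrite mulr0.
    by rewrite mulrDr; apply: WD; [apply: h1 | apply: h2].
  by rewrite mulrCA; apply/WM/h1.
apply: (@ideal_gen_min _ _ [set x | W (x * phi 'X_[b])]) => [|_ [i _ <-]].
  split=> [|x1 x2 h1 h2|c x1 h1] /=; first by rewrite mul0r.
    by rewrite mulrDl; apply: WD.
  by rewrite -mulrA; apply: WM.
by rewrite /= -rmorphM -mpolyXD; apply: Wb; rewrite mdegD mdeg1 br.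
Qed.

(** Together with bracket_vanishes: m^[q] is the image of the monomial ideal
    generated by the x_i ^ q. *)
Lemma vanishes_bracket (g : {mpoly k[N]}) :
  vanishes box g -> bracket_pow max q (phi g).
Proof.
move=> g0; rewrite [g]mpolyE rmorph_sum; apply: ideal_sum => [|m mg _].
  exact: ideal_gen_ideal.
have [_ _ IM] := @ideal_gen_ideal _ [set x ^+ q | x in max].
have [i qi] : exists i, (q <= m i)%N.
  apply/existsP; apply: contraLR mg; rewrite negb_exists => /forallP mq.
  rewrite -mcoeff_eq0 g0 ?eqxx //; apply/belowP => i.
  by rewrite ltnNge.
have mE : m = (m - U_(i) *+ q + U_(i) *+ q)%MM.
  by rewrite submK //; apply/mnm_lepP => j; rewrite mulmn1E; case: eqP => // <-.
rewrite {2}mE mpolyXD scalerAl rmorphM -mpolyXn rmorphXn; apply: IM.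
by apply: mem_ideal_gen; exists (phi 'X_i) => //; exact: max_var.
Qed.

Lemma bracket_vanishes z : bracket_pow max q z ->
  exists2 g, vanishes box g & z = phi g.
Proof.
pose W : set R := fun z => exists2 g, vanishes box g & z = phi g.
have WI : is_ideal W.
  split; first by exists 0; rewrite ?rmorph0 // => b _; rewrite mcoeff0.
    by move=> _ _ [g g0 ->] [h h0 ->]; exists (g + h); rewrite ?rmorphD //; apply: vanishesD.
  move=> c _ [g g0 ->]; have [c' <-] := phi_onto c.
  by exists (c' * g); rewrite ?rmorphM //; apply: vanishesM.
have [W0 WD WM] := WI.
apply: (@ideal_gen_min _ _ W) => // _ [x mx <-].
have pR : p \in [pchar R].
  exact: (rmorph_pchar phi) (pchar_mpoly N pk).
apply: (@ideal_gen_min _ _ [set x | W (x ^+ q)]) mx => [|_ [i _ <-]]; last first.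
  exists ('X_i ^+ q); last by rewrite rmorphXn.
  move=> b /belowP bq; rewrite mpolyXn mcoeffX; case: eqP => // bE.
  by have := bq i; rewrite -bE mulmn1E eqxx ltnn.
split=> [|x1 x2 h1 h2|c x1 h1] /=.
- by rewrite expr0n eqn0Ngt q_gt0.
- have -> : (x1 + x2) ^+ q = x1 ^+ q + x2 ^+ q.
    have := expr_sum_pchar e [:: x1; x2] id pR.
    by rewrite !big_cons !big_nil !addr0.
  exact: WD.
- by rewrite exprMn; apply: WM.
Qed.

Local Notation top := ([multinom q.-1 | i < N] : 'X_{1..N}).

Lemma mdeg_compl (b : 'X_{1..N}) : below box b ->
  (mdeg (top - b)%MM + mdeg b = N * q.-1)%N /\ (top - (top - b) = b)%MM.
Proof.
move=> /belowP bq; split.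
  rewrite -mdegD submK; last first.
    by apply/mnm_lepP => i; rewrite mnmE; have := bq i; lia.
  by rewrite mdegE (eq_bigr (fun=> q.-1)) ?sum_nat_const ?card_ord // => i _; rewrite mnmE.
by apply/mnmP => i; rewrite !mnmBE mnmE; have := bq i; lia.
Qed.

Lemma below_top b : below box (top - b)%MM.
Proof. by apply/belowP => i; rewrite mnmBE mnmE; have := q_gt0; lia. Qed.

(** For an annihilator u, the linear form taking g to the top coefficient of
    u * g kills both f and the x_i ^ q, but not the monomial complementary to
    a point of the support of u. This form is the socle pairing of the
    Gorenstein ring S / (x_i ^ q). *)
Lemma not_sub_of_ann t : has_ann k a box t ->
  (t <= N * q.-1)%N /\
  ~ (ideal_pow max (N * q.-1 - t) `<=` bracket_pow max q)%classic.
Proof.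
move=> [u ua [b [bq bt] ub]]; have [bd bb] := mdeg_compl bq.
split=> [|sub]; first by rewrite -bd bt leq_addl.
have [h fh [hu _]] := annihilates_poly ua.
have rE : (N * q.-1 - t = mdeg (top - b)%MM)%N by rewrite -bd bt addnK.
rewrite rE in sub; have /bracket_vanishes [g g0 /eqP] := sub _ (monomial_ideal_pow _).
rewrite -subr_eq0 -rmorphB => /eqP/phi_ker [h' Xg].
have XE : 'X_[top - b] = g + h' * f :> {mpoly k[N]} by rewrite -Xg addrC subrK.
have hX : (h * 'X_[top - b])@_top = u b.
  rewrite mulrC mcoeffXM; have -> : (top - b <= top)%MM.
    by apply/mnm_lepP => i; rewrite mnmBE leq_subr.
  by rewrite bb hu.
case/eqP: ub; rewrite -hX XE mulrDr mulrCA.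
have h0 : vanishes box (h * g + h' * (h * f)).
  by apply: vanishesD; [apply: vanishesM | rewrite [h * f]mulrC; apply: vanishesM].
apply: h0; apply/belowP => i; rewrite mnmE; have := q_gt0; lia.
Qed.

(** Conversely a linear form that kills the ideal and not a given monomial
    of degree r is read, through the complementary monomials, as an
    annihilator. *)
Lemma ann_of_not_sub r : ~ (ideal_pow max r `<=` bracket_pow max q)%classic ->
  (r <= N * q.-1)%N /\ has_ann k a box (N * q.-1 - r).
Proof.
move=> nsub; have brI := @ideal_gen_ideal _ [set x ^+ q | x in max].
have [b br bX] : exists2 b : 'X_{1..N}, mdeg b = r & ~ bracket_pow max q (phi 'X_[b]).
  apply: contrapT => nb; apply: nsub; apply: ideal_pow_sub => // b br.
  by apply: contrapT => bX; apply: nb; exists b.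
have bq : below box b.
  apply: contrapT => bq; apply: bX; apply: vanishes_bracket => b' b'q.
  by rewrite mcoeffX; case: eqP => // bb; case: bq; rewrite bb.
have [bd bb] := mdeg_compl bq.
split; first by rewrite -bd br leq_addl.
pose A (s g : {ffun 'I_N -> 'I_q}) : k := (f * 'X_[box_mnm s])@_(box_mnm g).
have mq (s : {ffun 'I_N -> 'I_q}) : below box (box_mnm s).
  by apply/belowP => i; rewrite box_mnmE ltn_ord.
have onto b' : below box b' -> exists s : {ffun 'I_N -> 'I_q}, box_mnm s = b'.
  exact: box_mnm_onto.
(* In the first case the monomial lies in the ideal. *)
have [[c cE]|[w Aw wb]] := span_or_functional A (fun g => (box_mnm g == b)%:R).
  case: bX; pose h := \sum_s c s *: 'X_[box_mnm s] : {mpoly k[N]}.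
  have -> : phi 'X_[b] = phi ('X_[b] - h * f).
    by apply/eqP; rewrite -subr_eq0 -rmorphB subKr; apply/eqP/phi_ker; exists h.
  apply: vanishes_bracket => b' /onto[g <-].
  rewrite mcoeffB mcoeffX eq_sym cE /h mulr_suml raddf_sum /= -sumrB big1 // => s _.
  by rewrite -scalerAl mcoeffZ [_ * f]mulrC subrr.
exists (fun b' => \sum_g w g * (box_mnm g == top - b')%MM%:R); last first.
  exists (top - b)%MM; first by split; [exact: below_top | rewrite -bd br addnK].
  by rewrite bb; under eq_bigr do rewrite mulrC.
move=> b' b'q; have [s sE] := onto _ (below_top b').
rewrite /shift_sum exchange_big /= -[RHS](Aw s); apply: eq_bigr => g _.
rewrite -mulr_sumr mulrC; congr (_ * _).
rewrite /A mcoeff_fermat /shift_sum big_mkcond [RHS]big_mkcond /=.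
apply: eq_bigr => i _; rewrite mcoeffX sE.
move/belowP: (mq g) => gq; move/belowP: b'q => b'q.
have qp := q_gt0.
have gE j : (box_mnm g == top - (b' - U_(i) *+ a))%MM ->
  box_mnm g j = (q.-1 - (b' j - if i == j then a else 0))%N.
  by move=> /eqP/mnmP/(_ j); rewrite !mnmBE mnmE mulmn1E.
have gE' j : (top - b' == box_mnm g - U_(i) *+ a)%MM ->
  (q.-1 - b' j = box_mnm g j - if i == j then a else 0)%N.
  by move=> /eqP/mnmP/(_ j); rewrite !mnmBE mnmE mulmn1E.
case: (leqP a (b' i)) => ab; case: (leqP a (box_mnm g i)) => ag.
- congr ((nat_of_bool _)%:R); apply/idP/idP => h; apply/eqP/mnmP => j.
    rewrite !mnmBE mnmE mulmn1E (gE j h).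
    by have := b'q j; case: eqP => [<-|_]; lia.
  rewrite !mnmBE mnmE mulmn1E; have := gE' j h; have := b'q j; have := gq j.
  by case: eqP => [<-|_]; lia.
- case: eqP => // /eqP h; have := gE i h; rewrite eqxx; have := b'q i; lia.
- case: eqP => // /eqP h; have := gE' i h; rewrite eqxx; have := b'q i; have := gq i; lia.
by [].
Qed.

End Duality.

(** * The limit *)

Section Threshold.
Variables (k : fieldType) (N p a e : nat).
Hypotheses (N3 : (3 < N)%N) (pk : p \in [pchar k]) (a0 : (0 < a)%N).
Local Notation q := (p ^ e)%N.
Hypotheses (aq : (a <= q)%N) (qpa : (q <= p * a)%N).
Hypotheses (oddk : odd p || (q %/ a == 1)%N).
Local Notation m := (fermat_max k N a0).
Local Notation pi := (\pi_(fermat_ring k N a0))%qT.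

Lemma pi_onto (z : fermat_ring k N a0) : exists g, pi g = z.
Proof. by exists (repr z); rewrite reprK. Qed.

Lemma pi_ker (g : {mpoly k[N]}) :
  pi g = 0 :> fermat_ring k N a0 <-> exists h, g = h * fermat_poly k N a.
Proof.
have -> : (pi g = 0 :> fermat_ring k N a0) <-> (g \in fermat_ideal a0).
  rewrite -[g in g \in _]subr0 Quotient.idealrBE rmorph0.
  by split=> [->|/eqP].
by split=> /asboolP.
Qed.

Lemma F_nu_exists e' : exists2 r, is_F_nu m m (p ^ e') r &
  (r <= N * (p ^ e').-1)%N /\
  has_ann k a (fun _ : 'I_N => p ^ e')%N (N * (p ^ e').-1 - r).
Proof.
pose S r := `[< ~ (ideal_pow m r `<=` bracket_pow m (p ^ e'))%classic >].
have SE r : S r -> (r <= N * (p ^ e').-1)%N /\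
    has_ann k a (fun _ : 'I_N => p ^ e')%N (N * (p ^ e').-1 - r).
  by move=> /asboolP; exact: (@ann_of_not_sub k N p a e' (fermat_ring k N a0) pi pi_ker pk r).
have exS : exists r, S r.
  have [||t _ ht] := @has_ann_fermat_pow k N p e' a (p ^ e')%N pk.
  - exact: q_gt0 pk.
  - by rewrite leq_pmull.
  exists (N * (p ^ e').-1 - t)%N; apply/asboolP.
  by have [] := @not_sub_of_ann k N p a e' (fermat_ring k N a0) pi pi_onto pi_ker pk t ht.
have [r Sr rmax] := ex_maxnP exS (fun r Sr => (SE r Sr).1).
exists r; last exact: SE.
by split=> [|r' Sr']; [apply/asboolP | apply: rmax; apply/asboolP].
Qed.

Lemma F_nu_bounds j r : is_F_nu m m (p ^ (e + j)) r ->
  (N * p ^ (e + j) <= r + p ^ j * mincost N p a e + N)%N /\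
  (r + p ^ j * mincost N p a e <= N * p ^ (e + j) + a * N.+1)%N.
Proof.
move=> [rP rmax]; have P0 := q_gt0 (e + j) pk.
have subE : (N * (p ^ (e + j)).-1 + N = N * p ^ (e + j))%N.
  by rewrite -mulnSr prednK.
have [rle hr] := @ann_of_not_sub k N p a (e + j) (fermat_ring k N a0) pi pi_ker pk r rP.
rewrite [in has_ann _ _ _ _]expnD in hr.
have := degree_ge N3 pk a0 aq qpa oddk hr.
have [t tle ht] := degree_le N3 pk a0 aq qpa oddk j.
rewrite -expnD in ht.
have [tle' nt] :=
  @not_sub_of_ann k N p a (e + j) (fermat_ring k N a0) pi pi_onto pi_ker pk t ht.
by have := rmax _ nt; rewrite -expnD; split; lia.
Qed.

Lemma threshold_of_mincost (K : realType) :
  is_F_threshold p m m (N%:R - (mincost N p a e)%:R / q%:R : K).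
Proof.
have [nu nuP] : exists nu : nat -> nat, forall e', is_F_nu m m (p ^ e') (nu e').
  have /(@choice nat nat) [nu nuP] : forall e', exists r, is_F_nu m m (p ^ e') r.
    by move=> e'; have [r] := F_nu_exists e'; exists r.
  by exists nu.
exists nu; split=> //; set mu := mincost N p a e.
have p1 : (1 < p)%N := prime_gt1 (pcharf_prime pk).
pose C := (a * N.+1 + N)%N.
have q0 : (0 : K) < q%:R by rewrite ltr0n (q_gt0 e pk).
apply/cvgrPdist_le => eps eps0.
near=> e'.
have ee' : (e <= e')%N by near: e'; exact: nbhs_infty_ge.
have Ce' : C%:R / eps <= e'%:R :> K by near: e'; exact: nbhs_infty_ger.
have := F_nu_bounds (j := e' - e) (r := nu e'); rewrite subnKC // => /(_ (nuP e')) [lo hi].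
have Q0 : (0 : K) < (p ^ e')%:R by rewrite ltr0n (q_gt0 e' pk).
have QE : (p ^ e')%:R = q%:R * (p ^ (e' - e))%:R :> K.
  by rewrite -natrM -expnD subnKC.
have -> : N%:R - mu%:R / q%:R =
    (N%:R * (p ^ e')%:R - (p ^ (e' - e) * mu)%N%:R) / (p ^ e')%:R :> K.
  rewrite natrM mulrBl mulfK ?gt_eqF //; congr (_ - _).
  rewrite QE; field.
  by rewrite !pnatr_eq0 -!lt0n !(q_gt0 _ pk).
rewrite -mulrBl normrM normfV (gtr0_norm Q0) ler_pdivrMr //.
apply: (@le_trans _ _ C%:R).
  move: lo hi; rewrite -!(ler_nat K) !natrD !natrM -/mu /C ?natrD ?natrM => lo hi.
  have N0 : 0 <= N%:R :> K := ler0n _ _.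
  have a0' : 0 <= a%:R * N.+1%:R :> K by rewrite mulr_ge0.
  by rewrite ler_norml; apply/andP; split; lra.
rewrite -ler_pdivrMl // mulrC (le_trans Ce') // ler_nat ltnW //.
exact: ltn_expl.
Unshelve. all: by end_near.
Qed.

End Threshold.

Lemma ceil_half (K : realType) (n : nat) : Num.ceil (n%:R / 2 : K) = uphalf n.
Proof.
apply: ceil_def; have [oE|eE] : (2 * uphalf n = n)%N \/ (2 * uphalf n = n.+1)%N by lia.
  have : n%:R = 2 * (uphalf n)%:R :> K by rewrite -oE natrM; congr (_ * (uphalf _)%:R); lia.
  by rewrite intrB -pmulrn; move: (uphalf n) => h ->; apply/andP; split; lra.
have : n%:R = 2 * (uphalf n)%:R - 1 :> K by rewrite -natrM eE -natr1 addrK.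
by rewrite intrB -pmulrn; move: (uphalf n) => h ->; apply/andP; split; lra.
Qed.

Unset Implicit Arguments.
Unset Strict Implicit.

Theorem theorem4p2 (K : realType) (n : nat) (hn : (3 <= n)%N)
    (k : fieldType) (p : nat) (hp : p \in [pchar k])
    (a : nat) (ha : (0 < a)%N) (hpa : ~~ (p %| a)%N)
    (e : nat) (he : (a <= p ^ e)%N)
    (hemin : forall e', (a <= p ^ e')%N -> (e <= e')%N) :
  let kappa : K := (p ^ e %/ a)%N%:R in
  let s : K := (p ^ e %% a)%N%:R in
  let q : K := (p ^ e)%N%:R in
  let N : K := n%:R in
  let A : K := a%:R in
  let m1 : K := (Num.ceil (((N + 1) * kappa - N + 1) / 2))%:~R / q
                + (N + 1) * s / (A * q) in
  let m2 : K := (Num.ceil (((N + 1) * kappa - N + 2) / 2))%:~R / q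
                + N * s / (A * q) in
  let m3 : K := (Num.ceil (((N + 1) * kappa + 1) / 2))%:~R / q
                + s / (A * q) in
  let m4 : K := (Num.ceil (((N + 1) * kappa + 2) / 2))%:~R / q in
  (* integer exponent: e - 1 = -1 when a = 1 *)
  let m5 : K := 1 / (p%:R ^ (e%:Z - 1)) in
  let M : K := Num.min m1 (Num.min m2 (Num.min m3 (Num.min m4 m5))) in
  is_F_threshold p (fermat_max k n.+1 ha) (fermat_max k n.+1 ha)
    (N + 1 - A * M).
Proof.
move=> kappa s q N A m1 m2 m3 m4 m5 M.
have p1 : (1 < p)%N := prime_gt1 (pcharf_prime hp).
have q0 : (0 < p ^ e)%N by rewrite expn_gt0 ltnW.
have qpa : (p ^ e < p * a)%N.
  have [e0|e0] := posnP e; first by rewrite e0 expn0 (leq_trans p1) ?leq_pmulr.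
  rewrite -(prednK e0) expnS ltn_pmul2l ?(ltnW p1) // ltnNge.
  by apply/negP => /hemin; rewrite -{1}(prednK e0) ltnn.
have kp : (p ^ e %/ a < p)%N by rewrite ltn_divLR.
have k0 : (0 < p ^ e %/ a)%N by rewrite divn_gt0.
have oddk : odd p || (p ^ e %/ a == 1)%N.
  have [p2|->//] := even_prime (pcharf_prime hp).
  by rewrite eqn_leq k0 andbT -ltnS -[in (_ < 2)%N]p2 kp orbT.
suff -> : N + 1 - A * M = n.+1%:R - (mincost n.+1 p a e)%:R / q :> K.
  exact: (@threshold_of_mincost k n.+1 p a e hn hp ha he (ltnW qpa) oddk K).
rewrite natr1; congr (_ - _).
have A0 : 0 < A by rewrite ltr0n.
have Q0 : 0 < q by rewrite ltr0n.
have nk : (n.+1 <= n.+1 * (p ^ e %/ a))%N by rewrite leq_pmulr.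
have ceilE l (x : K) : (l <= n.+1)%N -> x = (N + 1) * kappa + 2 - l%:R ->
    Num.ceil (x / 2) = uphalf (n.+1 * (p ^ e %/ a) + 2 - l).
  move=> ln ->; rewrite -(ceil_half K) natrB; last by lia.
  by rewrite natrD natrM -(natr1 n).
have costE l (c x y : K) : c = (uphalf (n.+1 * (p ^ e %/ a) + 2 - l))%:~R ->
    x = l%:R -> A * (c / q + x * s / (A * q)) = (cost n.+1 p a e l)%:R / q.
  move=> -> ->; rewrite /cost natrD !natrM -pmulrn -/A -/s.
  by field; rewrite !gt_eqF.
have A1 : A * m1 = (cost n.+1 p a e n.+1)%:R / q.
  apply: costE => //; last by rewrite -(natr1 n).
  by rewrite (ceilE n.+1) // -(natr1 n) -/N; ring.
have A2 : A * m2 = (cost n.+1 p a e n)%:R / q.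
  by apply: costE => //; rewrite (ceilE n) // -/N; ring.
have A3 : A * m3 = (cost n.+1 p a e 1)%:R / q.
  have := costE 1%N _ 1 0 erefl erefl; rewrite mul1r => <-.
  by rewrite /m3 (ceilE 1%N) //; ring.
have A4 : A * m4 = (cost n.+1 p a e 0)%:R / q.
  have := costE 0%N _ 0 0 erefl erefl; rewrite !mul0r addr0 => <-.
  by rewrite /m4 (ceilE 0%N) //; ring.
have A5 : A * m5 = (a * p)%:R / q.
  have P0 : p%:R != 0 :> K by rewrite pnatr_eq0 -lt0n ltnW.
  rewrite /m5 expfzDr // exprN1 natrM -/A -exprnP -natrX -/q.
  by field; rewrite P0 gt_eqF.
rewrite /M !(minr_pMr _ _ (ltW A0)) A1 A2 A3 A4 A5.
rewrite /mincost -!minEnat !natr_min !minr_pMl //.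
all: by rewrite invr_ge0 ltW.
Qed.
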